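(* Let $F$ be a field and let $\Gamma$ be a uniform layered graph. Then the $F$-algebra $R=R(\Gamma)$ is Koszul if and only if for every $x\in\Gamma'$ and every $0\le n\le rk(x)-1$: $$rann_R(r_x(n)) = r_x(n+1)R\oplus H_x(n+1).$$
   Context: A layered graph is identified with a finite ranked poset $\Gamma$: a finite poset with a unique minimal element $\bar 0$ such that for each $x$ all maximal chains in $[\bar 0,x]$ have the same length, called $rk(x)$. For $n\ge 0$ put $S_a(n)=\{b\le a : rk(a)-rk(b)=n\}$ (so $S_a(0)=\{a\}$). $\Gamma$ is uniform if for each $a\ne\bar 0$ the equivalence relation on $S_a(1)$ generated by [$b\sim c$ if $b=c$ or $S_b(1)\cap S_c(1)\neq\emptyset$] has only one equivalence class. Put $\Gamma'=\Gamma\setminus\{\bar 0\}$. Let $W$ be the $F$-vector space with basis $\{r_x : x\in\Gamma'\}$. For $x\in\Gamma'$ put $r_x(n)=\sum_{y\in S_x(n)} r_y$ for $0\le n\le rk(x)-1$ (so $r_x(0)=r_x$) and $r_x(n)=0$ for $n\ge rk(x)$. Then $R(\Gamma)=T(W)/I$, where $I$ is the two-sided ideal generated by all $r_x\otimes r_y$ with $x,y\in\Gamma'$, $y\notin S_x(1)$, and all $r_x\otimes r_x(1)$ with $x\in\Gamma'$. It is graded with each $r_x$ in degree 1. For $x\in\Gamma'$ and $n\ge0$, $H_x(n)=\sum_{y\in\Gamma',\,y\notin S_x(n)} r_yR$, a right ideal of $R$. For $a\in R$, $rann_R(a)=\{b\in R : ab=0\}$ is the right annihilator. A connected graded $F$-algebra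 $R$ generated in degree 1 is Koszul if its trivial module $R/R_+=F$ has a linear graded projective resolution. *)

(* Defs.v *)
From HB Require Import structures.
From mathcomp Require Import all_boot all_order all_algebra finmap.
From mathcomp Require Import boolp classical_sets.
From mathcomp.multinomials Require Import monalg.

Set Implicit Arguments.
Unset Strict Implicit.
Unset Printing Implicit Defensive.

Import Order.TTheory GRing.Theory.
Local Open Scope ring_scope.
Local Open Scope quotient_scope.

Section Chains.
Context (d : Order.disp_t) (T : finPOrderType d).
Implicit Types (a b : T) (C : {set T}).

Definition is_minimal a := forall b, (b <= a)%O -> b = a.

Definition chain_in a b C : bool :=
  (C \subset [set c | (a <= c <= b)%O]) &&
  [forall c in C, forall e in C, ((c <= e) || (e <= c))%O].

Definition maximal_chain a b C : bool := maxset (chain_in a b) C.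

End Chains.

(* The length of a chain is its number of steps, i.e. its cardinality minus
   one; every interval [0, x] has a maximal chain, so [lg_rk] is determined
   by the poset. *)
Record layeredGraph := LayeredGraph {
  lg_disp : Order.disp_t;
  lg_sort :> finPOrderType lg_disp;
  lg_bot : lg_sort;
  lg_botP : forall x : lg_sort, is_minimal x <-> x = lg_bot;
  lg_rk : lg_sort -> nat;
  lg_rkP : forall (x : lg_sort) (C : {set lg_sort}),
    maximal_chain lg_bot x C -> #|C| = (lg_rk x).+1
}.

Arguments lg_bot {l}.

Section LayeredGraph.
Context (G : layeredGraph).
Implicit Types a b c : G.

Definition lower a (n : nat) : {set G} :=
  [set b | (b <= a)%O & lg_rk a == (lg_rk b + n)%N].

Definition linked a : rel G := fun b c =>
  [&& b \in lower a 1, c \in lower a 1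
    & (b == c) || (lower b 1 :&: lower c 1 != finset.set0)].

(* [linked a] is symmetric, so its reflexive-transitive closure [connect] is
   the equivalence relation it generates. *)
Definition uniform : Prop :=
  forall a, a != lg_bot ->
  forall b c, b \in lower a 1 -> c \in lower a 1 -> connect (linked a) b c.

End LayeredGraph.

Notation nonbot G := {x : lg_sort G | x != lg_bot}.

(* [V] is the internal direct sum of the subgroups [deg i]. *)
Definition is_grading (J : eqType) (V : zmodType) (deg : J -> V -> Prop) :=
  [/\ forall i, deg i 0,
      forall i u v, deg i u -> deg i v -> deg i (u - v),
      forall v, exists (s : seq J) (f : J -> V),
        [/\ uniq s, forall i, deg i (f i) & v = \sum_(i <- s) f i]
    & forall (s : seq J) (f : J -> V), uniq s -> (forall i, deg i (f i)) ->
        \sum_(i <- s) f i = 0 -> forall i, i \in s -> f i = 0].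

Record connGradedAlg (F : fieldType) := ConnGradedAlg {
  cg_sort :> algType F;
  cg_deg : nat -> cg_sort -> Prop;
  cg_grading : is_grading cg_deg;
  cg_scale : forall n (c : F) a, cg_deg n a -> cg_deg n (c *: a);
  cg_mul : forall m n a b, cg_deg m a -> cg_deg n b -> cg_deg (m + n) (a * b);
  cg_conn : forall a, cg_deg 0 a <-> exists c : F, a = c%:A;
  cg_gen1 : forall B : cg_sort -> Prop,
    B 1 -> (forall (c : F) a b, B a -> B b -> B (c *: a + b)) ->
    (forall a b, B a -> B b -> B (a * b)) ->
    (forall a, cg_deg 1 a -> B a) -> forall a, B a
}.

Section GradedModules.
Context (F : fieldType) (A : connGradedAlg F).

(* Right A-modules are left modules over the converse ring A^c. *)
Definition ract (M : lmodType A^c) (m : M) (a : A) : M := (a : A^c) *: m.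

Record grMod := GrMod {
  gm_sort :> lmodType A^c;
  gm_deg : int -> gm_sort -> Prop;
  gm_grading : is_grading gm_deg;
  gm_act : forall i n (m : gm_sort) (a : A),
    gm_deg i m -> cg_deg n a -> gm_deg (i + n%:Z) (ract m a)
}.

Definition deg_preserving (M N : grMod) (f : M -> N) :=
  forall i m, gm_deg i m -> gm_deg i (f m).

Definition gr_projective (P : grMod) : Prop :=
  forall (M N : grMod) (g : {linear M -> N}) (f : {linear P -> N}),
    deg_preserving g -> deg_preserving f -> (forall z, exists y, g y = z) ->
  exists2 h : {linear P -> M}, deg_preserving h & forall p, g (h p) = f p.

Definition generated_in (i : int) (M : grMod) : Prop :=
  forall m : M, exists (k : nat) (u : 'I_k -> M) (a : 'I_k -> A),
    (forall j, gm_deg i (u j)) /\ m = \sum_(j < k) ract (u j) (a j).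

(* ... -> P 2 -> P 1 -> P 0 -> M -> 0 *)
Record linear_resolution (M : grMod) (P : nat -> grMod)
    (d : forall i, {linear P i.+1 -> P i}) (e : {linear P 0 -> M}) : Prop :=
  LinearResolution {
    lr_proj : forall i, gr_projective (P i);
    lr_lin : forall i : nat, generated_in i%:Z (P i);
    lr_deg : forall i, deg_preserving (d i);
    lr_deg0 : deg_preserving e;
    lr_surj : forall m, exists p, e p = m;
    lr_exact0 : forall p, e p = 0 <-> exists q, p = d 0 q;
    lr_exact : forall i p, d i p = 0 <-> exists q, p = d i.+1 q
  }.

Definition irrelevant : {pred A} := fun a =>
  `[< exists (k : nat) (f : nat -> A),
      (forall n, cg_deg n.+1 (f n)) /\ a = \sum_(n < k) f n >].

Lemma cg_degD n (a b : A) : cg_deg n a -> cg_deg n b -> cg_deg n (a + b).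
Proof.
have [d0 dB _ _] := cg_grading A => ha hb.
by rewrite -[b]opprK -[- b]add0r; apply: (dB) => //; apply: (dB).
Qed.

Lemma irrelevant_hom n (a : A) : cg_deg n.+1 a -> a \in irrelevant.
Proof.
have [d0 _ _ _] := cg_grading A => ha; apply/asboolP.
exists n.+1, (fun k => if k == n then a else 0); split=> [k|].
  by case: eqP => [->|_].
by rewrite big_ord_recr /= eqxx big1 ?add0r // => i _; rewrite ltn_eqF.
Qed.

Lemma irrelevantD : {in irrelevant &, forall a b, a + b \in irrelevant}.
Proof.
have [d0 _ _ _] := cg_grading A.
move=> a b /asboolP[k [f [hf ->]]] /asboolP[l [g [hg ->]]]; apply/asboolP.
exists (maxn k l), (fun n => (if (n < k)%N then f n else 0) +
                            (if (n < l)%N then g n else 0)); split=> [n|].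
  by apply: cg_degD; case: ifP.
rewrite big_split /= -!big_mkcond /=; congr (_ + _).
  by rewrite (big_ord_widen _ f (leq_maxl k l)).
by rewrite (big_ord_widen _ g (leq_maxr k l)).
Qed.

Lemma irrelevant0 : 0 \in irrelevant.
Proof.
have [d0 _ _ _] := cg_grading A.
by apply/asboolP; exists 0%N, (fun=> 0); rewrite big_ord0.
Qed.

Lemma irrelevant_sum (I : Type) (s : seq I) (f : I -> A) :
  (forall i, f i \in irrelevant) -> \sum_(i <- s) f i \in irrelevant.
Proof.
move=> hf; elim/big_ind: _ => [|x y hx hy|//]; first exact: irrelevant0.
exact: irrelevantD.
Qed.

Lemma irrelevant_mul : {in irrelevant, forall a b, a * b \in irrelevant}.
Proof.
move=> a /asboolP[k [f [hf ->]]] b; have [_ _ dec _] := cg_grading A.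
have [s [g [_ hg ->]]] := dec b.
rewrite mulr_suml; apply: irrelevant_sum => i; rewrite mulr_sumr.
by apply: irrelevant_sum => j; have := cg_mul (hf i) (hg j) => /irrelevant_hom.
Qed.

Lemma irrelevant_mull n (a b : A) : cg_deg n.+1 b -> a * b \in irrelevant.
Proof.
move=> hb; have [_ _ dec _] := cg_grading A.
have [s [g [_ hg ->]]] := dec a; rewrite mulr_suml.
apply: irrelevant_sum => i; have := cg_mul (hg i) hb.
by rewrite addnS => /irrelevant_hom.
Qed.

Lemma irrelevant_zmod : zmod_closed irrelevant.
Proof.
split=> [|a b ha hb]; first exact: irrelevant0.
by rewrite -[b]mulr1 -mulrN irrelevantD // irrelevant_mul.
Qed.

HB.instance Definition _ := GRing.isZmodClosed.Build A irrelevant irrelevant_zmod.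

Definition trivial_sort := Quotient.quot irrelevant.
HB.instance Definition _ := GRing.Zmodule.on trivial_sort.
HB.instance Definition _ := EqQuotient.on trivial_sort.

Definition trivial_scale (a : A^c) (m : trivial_sort) : trivial_sort :=
  \pi_trivial_sort (repr m * (a : A)).

Lemma trivial_piB (a b : A) :
  (\pi_trivial_sort a = \pi_trivial_sort b) <-> (a - b \in irrelevant).
Proof. by rewrite Quotient.idealrBE; split=> /eqP. Qed.

Lemma trivial_scaleE (a b : A) :
  trivial_scale a (\pi_trivial_sort b) = \pi_trivial_sort (b * a).
Proof.
apply/trivial_piB; rewrite -mulrBl irrelevant_mul //.
by apply/trivial_piB; rewrite reprK.
Qed.

Lemma trivial_scaleA (a b : A^c) m :
  trivial_scale a (trivial_scale b m) = trivial_scale (a * b) m.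
Proof.
elim/quotW: m => m.
by rewrite (trivial_scaleE b) !trivial_scaleE -mulrA.
Qed.

Lemma trivial_scale1 : left_id 1 trivial_scale.
Proof. by elim/quotW=> m; rewrite trivial_scaleE mulr1. Qed.

Lemma trivial_piD (a b : A) :
  \pi_trivial_sort (a + b) = \pi_trivial_sort a + \pi_trivial_sort b.
Proof. exact: raddfD. Qed.

Lemma trivial_scaleDr : right_distributive trivial_scale +%R.
Proof.
move=> a; elim/quotW=> m; elim/quotW=> n; rewrite -trivial_piD !trivial_scaleE.
by rewrite mulrDl trivial_piD.
Qed.

Lemma trivial_scaleDl m : {morph trivial_scale^~ m : a b / a + b}.
Proof.
by move=> a b; elim/quotW: m => m; rewrite !trivial_scaleE mulrDr trivial_piD.
Qed.

HB.instance Definition _ := GRing.Zmodule_isLmodule.Build A^c trivial_sort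
  trivial_scaleA trivial_scale1 trivial_scaleDr trivial_scaleDl.

Definition trivial_deg (i : int) (m : trivial_sort) : Prop :=
  i = 0 \/ m = 0.

Lemma trivial_grading : is_grading trivial_deg.
Proof.
split=> [i|i u v|v|s f us hf s0 i si].
- by right.
- by case=> [->|->]; [left|case=> [->|->]; [left|right; rewrite subr0]].
- exists [:: 0], (fun i => if i == 0 then v else 0); split=> // [i|].
    by case: eqP => [->|_]; [left|right].
  by rewrite big_seq1 eqxx.
- have h j : j != 0 -> f j = 0 by case: (hf j) => [->|//]; rewrite eqxx.
  have [i0|/h//] := eqVneq i 0; subst i.
  rewrite (bigD1_seq 0) //= big1 ?addr0 // in s0.
Qed.

Lemma trivial_act i n (m : trivial_sort) (a : A) :
  trivial_deg i m -> cg_deg n a -> trivial_deg (i + n%:Z) (ract m a).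
Proof.
case: n => [|n] hm ha; first by rewrite addr0; case: hm => [->|->];
  [left|right; rewrite /ract scaler0].
right; rewrite /ract; elim/quotW: m {hm} => m; rewrite [LHS]trivial_scaleE.
rewrite -[RHS](raddf0 (\pi_trivial_sort)).
by apply/trivial_piB; rewrite subr0 (irrelevant_mull _ ha).
Qed.

(* A / A_+ as a right module, concentrated in degree 0. *)
Definition trivial_mod : grMod := GrMod trivial_grading trivial_act.

Definition koszul : Prop :=
  exists (P : nat -> grMod) (d : forall i, {linear P i.+1 -> P i})
         (e : {linear P 0 -> trivial_mod}), linear_resolution d e.

End GradedModules.

Section TwoSidedIdeal.
Context (F : fieldType) (A : algType F) (S : A -> Prop).

Inductive ideal_gen : A -> Prop :=
| Ideal_gen a of S a : ideal_gen a
| Ideal_0 : ideal_gen 0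
| Ideal_add a b of ideal_gen a & ideal_gen b : ideal_gen (a + b)
| Ideal_mull c a of ideal_gen a : ideal_gen (c * a)
| Ideal_mulr a c of ideal_gen a : ideal_gen (a * c).

Definition in_ideal : {pred A} := fun a => `[< ideal_gen a >].

Lemma in_ideal_zmod : zmod_closed in_ideal.
Proof.
split=> [|a b /asboolP ha /asboolP hb]; apply/asboolP; first exact: Ideal_0.
by apply: Ideal_add => //; rewrite -mulN1r; apply: Ideal_mull.
Qed.

HB.instance Definition _ := GRing.isZmodClosed.Build A in_ideal in_ideal_zmod.

End TwoSidedIdeal.

Section SplittingAlgebra.
Context (F : fieldType) (G : layeredGraph).
Implicit Types x y : nonbot G.

(* T(W), for W with basis [nonbot G], is the free associative algebra on
   [nonbot G]: its basis consists of the words in [nonbot G]. *)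
Definition tensorAlg := {malg F[{fmonom (nonbot G)}]}.
HB.instance Definition _ := GRing.Lalgebra.on tensorAlg.

Lemma tensor_scaleAr (c : F) (a b : tensorAlg) : c *: (a * b) = a * (c *: b).
Proof.
have cC : c%:MP * a = a * c%:MP :> {malg F[{fmonom (nonbot G)}]}.
  rewrite !malgM_def fgmulUg fgmulgU; apply: eq_bigr => m _.
  by rewrite mul1m mulm1 mulrC.
by rewrite -![c *: _]mul_malgC mulrA [X in X * _]cC mulrA.
Qed.

HB.instance Definition _ :=
  GRing.Lalgebra_isAlgebra.Build F tensorAlg tensor_scaleAr.

Local Notation coef := (@mcoeff {fmonom (nonbot G)} F).
Local Notation supp := (@msupp {fmonom (nonbot G)} F).

Definition tgen x : tensorAlg := << fmu x >>.

Definition tgen_sum x (n : nat) : tensorAlg :=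
  if (n < lg_rk (val x))%N
  then \sum_(y : nonbot G | val y \in lower (val x) n) tgen y else 0.

Variant relator : tensorAlg -> Prop :=
| Relator_mul x y of val y \notin lower (val x) 1 : relator (tgen x * tgen y)
| Relator_sum x : relator (tgen x * tgen_sum x 1).

Notation I := (in_ideal relator).

Definition split_sort := Quotient.quot I.
HB.instance Definition _ := GRing.Zmodule.on split_sort.
HB.instance Definition _ := EqQuotient.on split_sort.

Definition split_pi (a : tensorAlg) : split_sort := \pi_split_sort a.

Lemma split_piP a b : split_pi a = split_pi b <-> ideal_gen relator (a - b).
Proof.
have -> : (split_pi a = split_pi b) <-> (a - b \in I).
  by rewrite Quotient.idealrBE; split=> /eqP.
by split=> /asboolP.
Qed.

Lemma split_piD a b : split_pi (a + b) = split_pi a + split_pi b.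
Proof. exact: raddfD. Qed.

Lemma split_piW (P : split_sort -> Prop) :
  (forall a, P (split_pi a)) -> forall r, P r.
Proof. by move=> h; elim/quotW=> a; apply: h. Qed.

Definition split_mul (r s : split_sort) : split_sort :=
  split_pi (repr r * repr s).
Definition split_scale (c : F) (r : split_sort) : split_sort :=
  split_pi (c *: repr r).

Lemma split_reprE a : ideal_gen relator (repr (split_pi a) - a).
Proof. by apply/split_piP; rewrite /split_pi reprK. Qed.

Lemma split_mulE a b : split_mul (split_pi a) (split_pi b) = split_pi (a * b).
Proof.
apply/split_piP; set a' := repr _; set b' := repr _.
have -> : a' * b' - a * b = (a' - a) * b' + a * (b' - b).
  by rewrite mulrBl mulrBr addrA subrK.
by apply: Ideal_add; [apply: Ideal_mulr|apply: Ideal_mull]; apply: split_reprE.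
Qed.

Lemma split_scaleE c a : split_scale c (split_pi a) = split_pi (c *: a).
Proof.
apply/split_piP; rewrite -scalerBr -[X in c *: X]mul1r scalerAl.
exact/Ideal_mull/split_reprE.
Qed.

(* Prevents [rewrite split_mulE] from unfolding [split_mul]. *)
Local Opaque split_mul split_scale split_pi.

Let splitE := (split_mulE, split_scaleE, =^~ split_piD).

Lemma split_mulA : associative split_mul.
Proof.
by do 3!elim/split_piW=> ?; rewrite !splitE mulrA.
Qed.

Lemma split_mul1 : left_id (split_pi 1) split_mul.
Proof. by elim/split_piW=> ?; rewrite splitE mul1r. Qed.

Lemma split_mulr1 : right_id (split_pi 1) split_mul.
Proof. by elim/split_piW=> ?; rewrite splitE mulr1. Qed.

Lemma split_mulDl : left_distributive split_mul +%R.
Proof. by do 3!elim/split_piW=> ?; rewrite !splitE mulrDl. Qed.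

Lemma split_mulDr : right_distributive split_mul +%R.
Proof. by do 3!elim/split_piW=> ?; rewrite !splitE mulrDr. Qed.

Lemma ideal_mcoeff1 (a : tensorAlg) : ideal_gen relator a -> coef mone a = 0.
Proof.
have g0 x : coef mone (tgen x) = 0.
  by rewrite mcoeffU1 fm1_eq1.
have mM (u v : tensorAlg) : coef mone (u * v) = coef mone u * coef mone v.
  exact: (@mcoeff1g_is_multiplicative _ F).1.
elim=> {a} [_ [x y _|x]||a b _ ha _ hb|c a _|a c _].
- by rewrite mM g0 mul0r.
- by rewrite mM g0 mul0r.
- exact: mcoeff0.
- by rewrite mcoeffD ha hb addr0.
- by move=> ha; rewrite mM ha mulr0.
- by move=> ha; rewrite mM ha mul0r.
Qed.

Lemma split_nonzero : split_pi 1 != 0.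
Proof.
apply/eqP; rewrite -[RHS](raddf0 (\pi_split_sort)) => /split_piP.
by rewrite subr0 => /ideal_mcoeff1/eqP; rewrite mcoeff1 eqxx oner_eq0.
Qed.

HB.instance Definition _ := GRing.Zmodule_isNzRing.Build split_sort
  split_mulA split_mul1 split_mulr1 split_mulDl split_mulDr split_nonzero.

Lemma split_scaleA c e (r : split_sort) :
  split_scale c (split_scale e r) = split_scale (c * e) r.
Proof. by elim/split_piW: r => ?; rewrite !splitE scalerA. Qed.

Lemma split_scale1 : left_id 1 split_scale.
Proof. by elim/split_piW=> ?; rewrite !splitE scale1r. Qed.

Lemma split_scaleDr : right_distributive split_scale +%R.
Proof. by move=> c; do 2!elim/split_piW=> ?; rewrite !splitE scalerDr. Qed.

Lemma split_scaleDl r : {morph split_scale^~ r : c e / c + e}.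
Proof. by move=> c e; elim/split_piW: r => ?; rewrite !splitE scalerDl. Qed.

HB.instance Definition _ := GRing.Zmodule_isLmodule.Build F split_sort
  split_scaleA split_scale1 split_scaleDr split_scaleDl.

Lemma split_scaleAl (c : F) (r s : split_sort) : c *: (r * s) = (c *: r) * s.
Proof.
elim/split_piW: r => a; elim/split_piW: s => b.
change (split_scale c (split_mul (split_pi a) (split_pi b)) =
        split_mul (split_scale c (split_pi a)) (split_pi b)).
by rewrite !splitE scalerAl.
Qed.

Lemma split_scaleAr (c : F) (r s : split_sort) : c *: (r * s) = r * (c *: s).
Proof.
elim/split_piW: r => a; elim/split_piW: s => b.
change (split_scale c (split_mul (split_pi a) (split_pi b)) =
        split_mul (split_pi a) (split_scale c (split_pi b))).
by rewrite !splitE scalerAr.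
Qed.

HB.instance Definition _ :=
  GRing.Lmodule_isLalgebra.Build F split_sort split_scaleAl.
HB.instance Definition _ :=
  GRing.Lalgebra_isAlgebra.Build F split_sort split_scaleAr.

Lemma split_piM a b : split_pi (a * b) = split_pi a * split_pi b.
Proof. by rewrite -split_mulE. Qed.

Lemma split_piZ c a : split_pi (c *: a) = c *: split_pi a.
Proof. by rewrite -split_scaleE. Qed.

Lemma split_pi0 : split_pi 0 = 0.
Proof. exact: (raddf0 (\pi_split_sort)). Qed.

Lemma split_pi_eq0 a : split_pi a = 0 <-> ideal_gen relator a.
Proof. by rewrite -split_pi0 split_piP subr0. Qed.

Lemma split_pi_sum (J : Type) (s : seq J) (P : pred J) (f : J -> tensorAlg) :
  split_pi (\sum_(i <- s | P i) f i) = \sum_(i <- s | P i) split_pi (f i).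
Proof. exact: (big_morph split_pi split_piD split_pi0). Qed.

Definition homogen (n : nat) (a : tensorAlg) : Prop :=
  forall m, coef m a != 0 -> fdeg m = n.

Definition hpart (n : nat) (a : tensorAlg) : tensorAlg :=
  [malg m in supp a => if fdeg m == n then coef m a else 0].

Lemma hpartE n a m : coef m (hpart n a) = if fdeg m == n then coef m a else 0.
Proof.
rewrite mcoeffE; case: ifP => // /negbT /mcoeff_outdom ->.
by rewrite if_same.
Qed.

Lemma homogen_hpart n a : homogen n (hpart n a).
Proof. by move=> m; rewrite hpartE; have [//|_ /eqP] := eqVneq (fdeg m) n. Qed.

Lemma hpart_homogen n k a : homogen n a -> hpart k a = if n == k then a else 0.
Proof.
move=> ha; apply/malgP=> m; rewrite hpartE.
have [a0|/ha ->] := eqVneq (coef m a) 0; last by case: ifP => //; rewrite mcoeff0.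
by rewrite a0 if_same; case: ifP; rewrite ?mcoeff0.
Qed.

Lemma hpartD n a b : hpart n (a + b) = hpart n a + hpart n b.
Proof.
apply/malgP=> m; rewrite mcoeffD !hpartE mcoeffD.
by case: ifP; rewrite ?addr0.
Qed.

Lemma hpart0 n : hpart n 0 = 0.
Proof. by apply/malgP=> m; rewrite hpartE mcoeff0 if_same. Qed.

Lemma hpart_sum n (J : Type) (s : seq J) (P : pred J) (f : J -> tensorAlg) :
  hpart n (\sum_(i <- s | P i) f i) = \sum_(i <- s | P i) hpart n (f i).
Proof. exact: (big_morph (hpart n) (hpartD n) (hpart0 n)). Qed.

Lemma sum_hpart (a : tensorAlg) :
  exists N : nat, a = \sum_(n <- iota 0 N) hpart n a.
Proof.
exists (mmeasure (@fdeg _) a); apply/malgP=> m; rewrite raddf_sum /=.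
have [a0|am] := eqVneq (coef m a) 0.
  by rewrite a0 big1 // => n _; rewrite hpartE a0 if_same.
rewrite (bigD1_seq (fdeg m)) ?iota_uniq //=; last first.
  by rewrite mem_iota add0n leq0n mmeasure_mnm_lt // -mcoeff_neq0.
rewrite hpartE eqxx big1 ?addr0 // => n /negPf nm.
by rewrite hpartE eq_sym nm.
Qed.

Lemma homogenM m n a b : homogen m a -> homogen n b -> homogen (m + n) (a * b).
Proof.
move=> ha hb k; rewrite mcoeff_neq0 => /msuppM_le[k1 [k2 [h1 h2 ->]]].
by rewrite fdegM (ha k1) ?(hb k2) // mcoeff_neq0.
Qed.

Lemma homogen0 n : homogen n 0.
Proof. by move=> m; rewrite mcoeff0 eqxx. Qed.

Lemma homogenB n a b : homogen n a -> homogen n b -> homogen n (a - b).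
Proof.
move=> ha hb m; rewrite mcoeffB.
have [->|/ha//] := eqVneq (coef m a) 0.
by rewrite sub0r oppr_eq0 => /hb.
Qed.

Lemma homogenD n a b : homogen n a -> homogen n b -> homogen n (a + b).
Proof.
move=> ha hb; rewrite -[b]opprK -[- b]add0r.
by apply: homogenB => //; apply: homogenB => //; apply: homogen0.
Qed.

Lemma homogenZ n (c : F) a : homogen n a -> homogen n (c *: a).
Proof. by move=> ha m; rewrite mcoeffZ mulf_eq0 negb_or => /andP[_ /ha]. Qed.

Lemma homogen_sum n (J : Type) (s : seq J) (P : pred J) (f : J -> tensorAlg) :
  (forall i, homogen n (f i)) -> homogen n (\sum_(i <- s | P i) f i).
Proof.
by move=> hf; elim/big_ind: _ => // [|x y]; [apply: homogen0|apply: homogenD].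
Qed.

Lemma homogen_tgen x : homogen 1 (tgen x).
Proof.
move=> m; rewrite mcoeffU1; have [<- _|_] := eqVneq (fmu x) m.
  exact: fdegU.
by rewrite eqxx.
Qed.

Lemma homogen_tgen_sum x n : homogen 1 (tgen_sum x n).
Proof.
rewrite /tgen_sum; case: ifP => _; last exact: homogen0.
by apply: homogen_sum => i; apply: homogen_tgen.
Qed.

Lemma ideal_sum (J : Type) (s : seq J) (f : J -> tensorAlg) :
  (forall i, ideal_gen relator (f i)) -> ideal_gen relator (\sum_(i <- s) f i).
Proof.
by move=> hf; elim/big_ind: _ => // [|x y]; [apply: Ideal_0|apply: Ideal_add].
Qed.

Lemma ideal_hpart (a : tensorAlg) n :
  ideal_gen relator a -> ideal_gen relator (hpart n a).
Proof.
move=> ha; elim: ha n => {a} [a ha|n|a b _ ha _ hb n|c a _ IH n|a c _ IH n]; first move=> n.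
- have h2 : homogen 2 a.
    by case: ha => [x y _|x]; apply: (homogenM (m := 1) (n := 1));
      [apply: homogen_tgen|apply: homogen_tgen|apply: homogen_tgen|apply: homogen_tgen_sum].
  rewrite (hpart_homogen n h2); case: ifP => _; last exact: Ideal_0.
  exact: Ideal_gen.
- by rewrite hpart0; apply: Ideal_0.
- by rewrite hpartD; apply: Ideal_add.
- have [N eN] := sum_hpart c; have [M eM] := sum_hpart a.
  rewrite [c]eN [X in _ * X]eM mulr_suml hpart_sum; apply: ideal_sum => i.
  rewrite mulr_sumr hpart_sum; apply: ideal_sum => j.
  rewrite (hpart_homogen n (homogenM (@homogen_hpart i c) (@homogen_hpart j a))).
  by case: ifP => _; [apply: Ideal_mull|apply: Ideal_0].
- have [N eN] := sum_hpart c; have [M eM] := sum_hpart a.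
  rewrite [c]eN [X in X * _]eM mulr_suml hpart_sum; apply: ideal_sum => i.
  rewrite mulr_sumr hpart_sum; apply: ideal_sum => j.
  rewrite (hpart_homogen n (homogenM (@homogen_hpart i a) (@homogen_hpart j c))).
  by case: ifP => _; [apply: Ideal_mulr|apply: Ideal_0].
Qed.

Definition split_deg (n : nat) (r : split_sort) : Prop :=
  exists2 a, homogen n a & r = split_pi a.

Lemma split_grading : is_grading split_deg.
Proof.
split=> [n|n u v [a ha ->] [b hb ->]|v|s f us hf s0 i si].
- by exists 0; [apply: homogen0|rewrite split_pi0].
- exists (a - b); first exact: homogenB.
  exact/esym/(raddfB (\pi_split_sort)).
- elim/split_piW: v => a; have [N eN] := sum_hpart a.
  exists (iota 0 N), (fun n => split_pi (hpart n a)); split.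
  + exact: iota_uniq.
  + by move=> n; exists (hpart n a) => //; apply: homogen_hpart.
  + by rewrite [in LHS]eN split_pi_sum.
- have /choice[g hg] : forall n, exists a, homogen n a /\ f n = split_pi a.
    by move=> n; case: (hf n) => a; exists a.
  have : split_pi (\sum_(j <- s) g j) = 0.
    by rewrite split_pi_sum -[RHS]s0; apply: eq_bigr => j _; case: (hg j).
  move=> /split_pi_eq0 /(ideal_hpart i); rewrite hpart_sum (bigD1_seq i) //=.
  rewrite (hpart_homogen i (hg i).1) eqxx big1 ?addr0 => [/split_pi_eq0|j ji].
    by rewrite (hg i).2.
  by rewrite (hpart_homogen i (hg j).1) (negPf ji).
Qed.

Lemma split_deg_scale n (c : F) (r : split_sort) :
  split_deg n r -> split_deg n (c *: r).
Proof.
by case=> a ha ->; exists (c *: a); [apply: homogenZ|rewrite split_piZ].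
Qed.

Lemma split_deg_mul m n (r s : split_sort) :
  split_deg m r -> split_deg n s -> split_deg (m + n) (r * s).
Proof.
by case=> a ha -> [b hb ->]; exists (a * b); [apply: homogenM|rewrite split_piM].
Qed.

Lemma split_conn (r : split_sort) :
  split_deg 0 r <-> exists c : F, r = c%:A.
Proof.
split=> [[a ha ->]|[c ->]].
  exists (coef mone a); rewrite -split_piZ; congr split_pi.
  apply/malgP=> m; rewrite mcoeffZ mcoeff1.
  have [->|m1] := eqVneq m mone; first by rewrite mulr1.
  rewrite mulr0; apply/eqP; apply: contraNT m1 => /ha/eqP.
  by rewrite fdeg_eq0.
exists (c *: 1); last by rewrite split_piZ.
apply: homogenZ => m; rewrite mcoeff1.
have [-> _|_] := eqVneq m mone; first exact: fdeg1.
by rewrite eqxx.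
Qed.

Lemma split_gen1 (B : split_sort -> Prop) :
  B 1 -> (forall (c : F) r s, B r -> B s -> B (c *: r + s)) ->
  (forall r s, B r -> B s -> B (r * s)) ->
  (forall r, split_deg 1 r -> B r) -> forall r, B r.
Proof.
move=> B1 BZ BM Bg; elim/split_piW=> a.
have B0 : B 0 by rewrite -(addNr (1 : split_sort)) -scaleN1r; apply: BZ.
have Bw (w : seq (nonbot G)) : B (split_pi << FMonom w >>).
  elim: w => [|x w IH].
    suff -> : FMonom [::] = mone :> {fmonom (nonbot G)} by [].
    by rewrite /mone /one /= fmoneE.
  have -> : << FMonom (x :: w) >> = tgen x * << FMonom w >> :> tensorAlg.
    rewrite [RHS]fgmulUU mulr1; congr << _ >>.
    by rewrite /mmul /mul /= fmmulE fmuE.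
  by rewrite split_piM; apply: BM => //; apply: Bg; exists (tgen x) => //;
    apply: homogen_tgen.
have -> : a = \sum_(m <- supp a) coef m a *: (<< m >> : tensorAlg).
  rewrite [LHS]monalgE; apply: eq_bigr => m _; apply/malgP=> k.
  by rewrite mcoeffZ !mcoeffU mulr_natr.
rewrite split_pi_sum; elim/big_rec: _ => // m r _ Br.
by rewrite split_piZ; apply: BZ => //; case: m => w; apply: Bw.
Qed.

Definition splitAlg : connGradedAlg F :=
  ConnGradedAlg split_grading split_deg_scale split_deg_mul split_conn
    split_gen1.

Definition rgen x : splitAlg := split_pi (tgen x).

Definition rgen_sum x (n : nat) : splitAlg := split_pi (tgen_sum x n).

Local Open Scope classical_set_scope.

Definition rideal (a : splitAlg) : set splitAlg :=
  [set a * b | b in [set: splitAlg]].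

Definition rann (a : splitAlg) : set splitAlg := [set b | a * b = 0].

Definition Hideal x (n : nat) : set splitAlg :=
  [set h | exists c : nonbot G -> splitAlg,
    h = \sum_(y : nonbot G | val y \notin lower (val x) n) rgen y * c y].

Definition direct_sum (U V W : set splitAlg) : Prop :=
  U = [set v + w | v in V & w in W] /\ V `&` W = [set 0].

End SplittingAlgebra.

Arguments rgen_sum F {G}.
Arguments Hideal F {G}.

(* Main.v *)
From HB Require Import structures.
Require Import Defs.
From mathcomp Require Import all_boot all_order all_algebra.
From mathcomp Require Import boolp zify.
From mathcomp.multinomials Require Import monalg.

(** The relations of R = R(Gamma) each begin with a single generator, so R_+ is
    the direct sum of the right ideals r_x R ([gen_direct]).  Consequently the
    right ideals generated by r_x(n+1) and by the r_y with y outside S_x(n+1)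
    are independent, and r_x(n) annihilates all of them.  What is at stake is
    whether they exhaust the annihilator of r_x(n).

    Cover R_+ by the modules r_x(0) R, and whenever a module r_x(n) R has
    appeared, cover the annihilator of r_x(n) by r_x(n+1) R and the r_y(0) R
    with y outside S_x(n+1).  Repeating this forever gives a complex of free
    modules whose i-th term is generated in degree i by the paths of length i
    in the graph of these choices ([path_diff]).  By the independence just
    described the cycles of the complex are computed coordinate by coordinate:
    a chain is a cycle when its coordinate at each path is killed by the last
    element of the path, and a boundary when this coordinate lies in the right
    ideal generated by the possible continuations of the path.  So the complex
    is exact if and only if the annihilators are as the theorem says, and then
    it is a linear free resolution of the trivial module.

    It remains to see that R can be Koszul only if this particular complex is
    exact.  Uniformity enters here: it forces an element of degree 1 that is
    killed by r_x(n) to have equal coefficients on the whole of S_x(n+1), and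
    so to lie in the expected right ideal ([gen_sum_strand]).  The complex is
    therefore exact in the lowest degree in which each term could carry
    homology.  Given some linear projective resolution P, one builds degree by
    degree isomorphisms from the terms of the complex to those of P
    ([free_comparison]): the cycles of P are generated in lowest degree, hence
    so are the cycles of the complex, and those are boundaries
    ([path_exact_of_koszul]). *)

Set Implicit Arguments.
Unset Strict Implicit.
Unset Printing Implicit Defensive.
Import Order.TTheory GRing.Theory.

(** * Ranks and uniformity in layered graphs *)

Section LayeredGraphTheory.
Context (G : layeredGraph).
Implicit Types (x y z u v w : G) (C D : {set G}).

(** Below [x] there is an element with the fewest elements below it; it is
    minimal, and the bottom is the only minimal element. *)
Lemma bot_le x : (lg_bot <= x)%O.
Proof.
pose size_below y := #|[set c : G | (c <= y)%O]|.
case: (arg_minnP size_below (lexx x : (fun y => y <= x)%O x)) => m le_mx min_m.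
suff /lg_botP <- : is_minimal m by [].
move=> b le_bm; apply: le_anti; rewrite le_bm /=.
have := min_m b (le_trans le_bm le_mx); apply: contraTT => nle_mb.
rewrite -ltnNge; apply: proper_card; apply/properP; split.
  by apply/subsetP=> c; rewrite !inE => /le_trans; apply.
by exists m; rewrite !inE.
Qed.

Lemma chain_in_setU1 a x y C :
  chain_in a x C -> (a <= y)%O -> (x <= y)%O -> chain_in a y (y |: C).
Proof.
case/andP=> /subsetP inC /'forall_implyP chC le_ay le_xy; apply/andP; split.
  apply/subsetP=> c; rewrite !inE => /predU1P[->|/inC]; first by rewrite le_ay lexx.
  by rewrite inE => /andP[-> /le_trans->].
have leC c : c \in C -> (c <= y)%O.
  by move/inC; rewrite inE => /andP[_ /le_trans]; apply.
apply/'forall_implyP=> c; rewrite !inE => /predU1P[->|cC];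
  apply/'forall_implyP=> e; rewrite !inE => /predU1P[->|eC].
- by rewrite lexx.
- by rewrite leC ?orbT.
- by rewrite leC.
- by have /'forall_implyP := chC c cC; apply.
Qed.

Lemma exists_maximal_chain x : exists C, maximal_chain lg_bot x C.
Proof.
have chain0 : chain_in lg_bot x (finset.set0 : {set G}).
  by rewrite /chain_in sub0set; apply/'forall_implyP=> c; rewrite inE.
by have [C maxC _] := maxset_exists chain0; exists C.
Qed.

(** A maximal chain up to [z] followed by [y] is a maximal chain up to [y]:
    an element that could be inserted is comparable with [z], so it lies either
    below [z] or, by the covering hypothesis, at [y]. *)
Lemma rank_cover y z :
  (z < y)%O -> (forall u, (z < u)%O -> (u <= y)%O -> u = y) ->
  lg_rk y = (lg_rk z).+1.
Proof.
move=> lt_zy cov; have [C maxC] := exists_maximal_chain z.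
have [chC topC] := maxsetP maxC.
have zC : z \in C.
  have := topC _ (chain_in_setU1 chC (bot_le z) (lexx z)) (subsetUr _ _).
  by move=> <-; rewrite !inE eqxx.
have yC : y \notin C.
  apply/negP=> /(subsetP (andP chC).1); rewrite inE => /andP[_ le_yz].
  by move: (lt_le_trans lt_zy le_yz); rewrite ltxx.
suff maxyC : maximal_chain lg_bot y (y |: C).
  by apply: succn_inj; rewrite -(lg_rkP maxyC) cardsU1 yC (lg_rkP maxC).
apply/maxsetP; split=> [|D chD sub_yC_D].
  exact: chain_in_setU1 chC (bot_le y) (ltW lt_zy).
have [/subsetP inD /'forall_implyP cmpD] := andP chD.
have /subsetP subCD : C \subset D := subset_trans (subsetUr _ _) sub_yC_D.
have yD : y \in D by rewrite (subsetP sub_yC_D) ?setU11.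
suff -> : C = D :\ y by rewrite setD1K.
apply/esym/topC; last by apply/subsetP=> c cC; rewrite !inE subCD // andbT;
  apply: contraNneq yC => <-.
apply/andP; split.
  apply/subsetP=> c; rewrite !inE => /andP[ne_cy cD]; rewrite bot_le /=.
  have /'forall_implyP/(_ z (subCD z zC))/orP[//|le_zc] := cmpD c cD.
  have [<-//|ne_zc] := eqVneq z c.
  have := inD c cD; rewrite inE bot_le /= => le_cy.
  by move: ne_cy; rewrite (cov c) ?eqxx // lt_neqAle ne_zc.
apply/'forall_implyP=> c; rewrite !inE => /andP[_ cD].
apply/'forall_implyP=> e; rewrite !inE => /andP[_ eD].
by have /'forall_implyP := cmpD c cD; apply.
Qed.

(** An element of the half-open interval with the fewest elements below it
    covers [z]. *)
Lemma exists_above x z : (z < x)%O ->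
  exists y, [/\ (z < y)%O, (y <= x)%O & lg_rk y = (lg_rk z).+1].
Proof.
move=> lt_zx; pose between u := (z < u <= x)%O.
have bx : between x by rewrite /between lt_zx lexx.
case: (arg_minnP (fun u => #|[set c : G | (c <= u)%O]|) bx) => y.
case/andP=> lt_zy le_yx min_y.
exists y; split=> //; apply: rank_cover => // u lt_zu le_uy.
apply: le_anti; rewrite le_uy /=.
have := min_y u; rewrite /between lt_zu (le_trans le_uy le_yx) => /(_ isT).
apply: contraTT => nle_yu; rewrite -ltnNge; apply: proper_card.
apply/properP; split; last by exists y; rewrite !inE.
by apply/subsetP=> c; rewrite !inE => /le_trans; apply.
Qed.

Lemma exists_below x z : (z < x)%O ->
  exists y, [/\ (z <= y)%O, (y < x)%O & lg_rk x = (lg_rk y).+1].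
Proof.
move=> lt_zx; pose between u := (z <= u < x)%O.
have bz : between z by rewrite /between lt_zx lexx.
case: (arg_maxnP (fun u => #|[set c : G | (c <= u)%O]|) bz) => y.
case/andP=> le_zy lt_yx max_y.
exists y; split=> //; apply: rank_cover => // u lt_yu le_ux.
apply/eqP; apply: contraTT lt_yu => ne_ux.
have := max_y u; rewrite /between lt_neqAle ne_ux le_ux andbT => max_yu.
apply/negP=> lt_yu; have := max_yu.
rewrite (le_trans le_zy (ltW lt_yu)) => /(_ isT); apply/negP; rewrite -ltnNge.
apply: proper_card.
apply/properP; split; last by exists u; rewrite !inE ?lexx ?lt_geF.
by apply/subsetP=> c; rewrite !inE => /le_trans; apply; apply: ltW.
Qed.

Lemma rank_lt x z : (z < x)%O -> lg_rk z < lg_rk x.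
Proof.
have [k] := ubnP #|[set c : G | (z < c)%O]|; elim: k z => // k IH z + lt_zx.
rewrite ltnS => le_k; have [y [lt_zy le_yx rk_y]] := exists_above lt_zx.
move: le_yx; rewrite le_eqVlt => /predU1P[<-|lt_yx]; first by rewrite rk_y.
rewrite (ltn_trans _ (IH y _ lt_yx)) ?rk_y //.
apply: leq_trans le_k; apply: proper_card; apply/properP; split.
  by apply/subsetP=> c; rewrite !inE; apply: lt_trans.
by exists y; rewrite !inE ?ltxx.
Qed.

Lemma rank_bot : lg_rk (lg_bot : G) = 0.
Proof.
have [C maxC] := exists_maximal_chain lg_bot.
apply/eqP; rewrite -leqn0 -ltnS -(lg_rkP maxC).
have /subset_leq_card : C \subset [set lg_bot].
  have /maxsetP[/andP[/subsetP inC _] _] := maxC.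
  by apply/subsetP=> c /inC; rewrite !inE => /andP[h1 h2]; rewrite eq_le h1 h2.
by rewrite cards1.
Qed.

Lemma rank_gt0 x : (0 < lg_rk x) = (x != lg_bot).
Proof.
have [->|nx] := eqVneq x lg_bot; first by rewrite rank_bot.
have := @rank_lt x lg_bot; rewrite rank_bot; apply.
by rewrite lt_neqAle eq_sym nx bot_le.
Qed.

Lemma lower0 x y : (y \in lower x 0) = (y == x).
Proof.
rewrite inE addn0; apply/andP/eqP=> [[]|->]; last by rewrite lexx eqxx.
rewrite le_eqVlt => /predU1P[//|/rank_lt].
by rewrite ltn_neqAle eq_sym => /andP[/negPf->].
Qed.

Lemma lower_trans x y z m n :
  y \in lower x m -> z \in lower y n -> z \in lower x (n + m).
Proof.
rewrite !inE => /andP[le_yx /eqP->] /andP[le_zy /eqP->].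
by rewrite (le_trans le_zy le_yx) addnA /=.
Qed.

Lemma lowerS_bottom x z n : z \in lower x n.+1 ->
  exists2 y, y \in lower x 1 & z \in lower y n.
Proof.
rewrite inE => /andP[le_zx /eqP rk_x].
have /exists_below[y [le_zy lt_yx rk_y]] : (z < x)%O.
  by rewrite lt_neqAle le_zx andbT; apply: contra_eq_neq rk_x => ->; lia.
exists y; rewrite inE; first by rewrite (ltW lt_yx) rk_y addn1 eqxx.
by rewrite le_zy -eqSS -rk_y rk_x addnS eqxx.
Qed.

Lemma lower_neq0 x n : n <= lg_rk x -> exists y, y \in lower x n.
Proof.
elim: n x => [|n IH] x le_nx; first by exists x; rewrite lower0.
have /exists_below[y [_ lt_yx rk_x]] : (lg_bot < x)%O.
  by rewrite lt_neqAle eq_sym -rank_gt0 (leq_trans _ le_nx) // bot_le.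
have /IH[z zy] : n <= lg_rk y by rewrite -ltnS -rk_x.
exists z; rewrite -addn1; apply: lower_trans zy.
by rewrite inE (ltW lt_yx) rk_x addn1 eqxx.
Qed.

(** A function that is constant on each S_y(1), for y at depth m below x, is
    constant on S_w(k+1) for w at depth m - k, by induction on k.  The sets
    S_v(k), with v in S_w(1), cover S_w(k+1), and uniformity joins any two such
    v by a sequence in which neighbours have a common element s immediately
    below them; then S_s(k-1) is a nonempty common part of their S_v(k). *)
Lemma uniform_lower_const (hG : uniform G) (U : Type) (c : G -> U) x m :
  (forall y, y \in lower x m -> forall z z', z \in lower y 1 ->
     z' \in lower y 1 -> c z = c z') ->
  forall z z', z \in lower x m.+1 -> z' \in lower x m.+1 -> c z = c z'.
Proof.
move=> hc; suff H k : forall l w, (k + l)%N = m -> w \in lower x l ->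
    forall z z', z \in lower w k.+1 -> z' \in lower w k.+1 -> c z = c z'.
  by apply: (H m 0); rewrite ?addn0 ?lower0.
elim: k => [|k IH] l w; first by rewrite add0n => ->; apply: hc.
move=> klm wx z z' zw z'w.
have cst v : v \in lower w 1 -> forall t t', t \in lower v k.+1 ->
    t' \in lower v k.+1 -> c t = c t'.
  move=> vw; apply: (IH l.+1); first by rewrite addnS.
  by have := lower_trans wx vw.
have [v vw zv] := lowerS_bottom zw; have [v' vw' zv'] := lowerS_bottom z'w.
have rk_w : lg_rk w = (lg_rk z + k.+2)%N.
  by move: zw; rewrite inE => /andP[_ /eqP].
have w_neq0 : w != lg_bot by rewrite -rank_gt0; lia.
have /connectP[p + def_v'] := hG w w_neq0 v v' vw vw'.
elim: p v vw z zv {zw rk_w} def_v' => [|u p IHp] v vw z zv /= def_v'.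
  by rewrite def_v' in zv' => _; apply: cst zv zv'.
case/andP=> /and3P[_ uw link] path_p.
have [t tv tu] : exists2 t, t \in lower v k.+1 & t \in lower u k.+1.
  have [<-|] := eqVneq v u; first by exists z.
  move=> ne_vu; move: link; rewrite (negPf ne_vu) /=.
  case/finset.set0Pn=> s; rewrite inE => /andP[sv su].
  have [t ts] : exists t, t \in lower s k.
    apply: lower_neq0; move: sv zv; rewrite !inE => /andP[_ /eqP rk1] /andP[_ /eqP]; lia.
  by exists t; rewrite -addn1; [apply: lower_trans sv ts|apply: lower_trans su ts].
rewrite (cst v vw z t) //; exact: (IHp u uw t).
Qed.

Lemma rank_nonbot (x : nonbot G) : 0 < lg_rk (val x).
Proof. by rewrite rank_gt0 (valP x). Qed.

Lemma lower_empty (x y : nonbot G) n : lg_rk (val x) <= n ->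
  (val y \in lower (val x) n) = false.
Proof.
move=> le_xn; apply/negP; rewrite inE => /andP[_ /eqP rk_x].
by have := rank_nonbot y; lia.
Qed.

End LayeredGraphTheory.

Local Open Scope ring_scope.

(** * Homogeneous components *)

Section Gradings.
Context (J : eqType) (V : zmodType) (deg : J -> V -> Prop).

(** The homogeneous components of a grading, as a family of additive
    projections: a grading by subgroups determines such a family, and on types
    of functions the family is easier to exhibit than the direct sum property. *)
Record grading_projection (p : J -> V -> V) : Prop := GradingProjection {
  proj_deg : forall i v, deg i (p i v);
  projD : forall i u v, p i (u + v) = p i u + p i v;
  proj_id : forall i v, deg i v -> p i v = v;
  proj_neq : forall i j v, deg j v -> i != j -> p i v = 0;
  proj_sum : forall v, exists2 s, uniq s & v = \sum_(i <- s) p i v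
}.

Lemma big_uniq_subset (s t : seq J) (f : J -> V) :
  uniq s -> uniq t -> {subset s <= t} ->
  \sum_(i <- t) (if i \in s then f i else 0) = \sum_(i <- s) f i.
Proof.
move=> us ut st; rewrite -big_mkcond -big_filter; apply: perm_big.
apply: uniq_perm => // [|i]; first exact: filter_uniq.
by rewrite mem_filter; case: (boolP (i \in s)) => // /st->.
Qed.

(** Two decompositions of the same element may have different supports, so
    the uniqueness of components is tested on the union of the supports. *)
Lemma exists_grading_projection : is_grading deg ->
  exists p, grading_projection p.
Proof.
case=> deg0 degB dec indep.
have degD i u v : deg i u -> deg i v -> deg i (u + v).
  move=> du dv; rewrite -[v]opprK; apply: (degB) => //.
  by rewrite -[- v]add0r; apply: degB.
pose sf v (t : seq J * (J -> V)) :=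
  [/\ uniq t.1, forall i, deg i (t.2 i) & v = \sum_(i <- t.1) t.2 i].
have /choice[t tP] : forall v, exists t, sf v t.
  by move=> v; have [s [f sfP]] := dec v; exists (s, f).
pose p i v := if i \in (t v).1 then (t v).2 i else 0.
have p_deg i v : deg i (p i v).
  by rewrite /p; case: ifP => // _; have [_ + _] := tP v.
have p_sum v s : uniq s -> {subset (t v).1 <= s} -> \sum_(i <- s) p i v = v.
  move=> us ts; have [ut _ {2}->] := tP v.
  exact: big_uniq_subset.
have p_char v s (f : J -> V) : uniq s -> (forall i, deg i (f i)) ->
    v = \sum_(i <- s) f i -> forall i, p i v = if i \in s then f i else 0.
  move=> us df def_v i; pose S := undup (s ++ (t v).1).
  have [|/negP] := boolP (i \in S); last first.
    rewrite mem_undup mem_cat => /negP; rewrite negb_or.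
    case/andP=> /negPf-> /negPf ti.
    by rewrite /p ti.
  move: i; pose g i := p i v - (if i \in s then f i else 0).
  suff H : forall i, i \in S -> g i = 0.
    by move=> i /H/eqP; rewrite subr_eq0 => /eqP.
  apply: indep => [|i|]; first exact: undup_uniq.
    by apply: (degB) => //; case: ifP.
  rewrite sumrB p_sum ?undup_uniq ?big_uniq_subset ?undup_uniq //.
  - by rewrite -def_v subrr.
  - by move=> i; rewrite mem_undup mem_cat => ->.
  - by move=> i; rewrite mem_undup mem_cat => ->; rewrite orbT.
exists p; split=> //.
- move=> i u v; pose S := undup ((t u).1 ++ (t v).1).
  rewrite (p_char _ S (fun j => p j u + p j v)) ?undup_uniq //; first last.
  + rewrite big_split /= !p_sum ?undup_uniq // => j.
      by rewrite mem_undup mem_cat => ->; rewrite orbT.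
    by rewrite mem_undup mem_cat => ->.
  + by move=> j; apply: degD.
  case: ifPn => //; rewrite mem_undup mem_cat negb_or /p.
  by case/andP=> /negPf-> /negPf->; rewrite addr0.
- move=> i v dv; rewrite (p_char _ [:: i] (fun j => if j == i then v else 0)) //.
  + by rewrite mem_seq1 !eqxx.
  + by move=> j; case: eqP => [->|].
  + by rewrite big_seq1 eqxx.
- move=> i j v dv /negPf ij; rewrite (p_char _ [:: j] (fun k => if k == j then v else 0)) //.
  + by rewrite mem_seq1 ij.
  + by move=> k; case: eqP => [->|].
  + by rewrite big_seq1 eqxx.
- by move=> v; have [ut _ _] := tP v; exists (t v).1; rewrite ?p_sum.
Qed.

Lemma grading_of_projection (p : J -> V -> V) :
  (forall i, deg i 0) -> (forall i u v, deg i u -> deg i v -> deg i (u - v)) ->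
  grading_projection p -> is_grading deg.
Proof.
move=> deg0 degB pP; split=> // [v|s f us df sum0 i si].
  have [s us def_v] := proj_sum pP v; exists s, (p^~ v); split=> // i.
  exact: proj_deg pP i v.
have p0 : p i 0 = 0 by rewrite (proj_id pP).
have := congr1 (p i) sum0; rewrite p0 (big_morph _ (projD pP i) p0).
rewrite (bigD1_seq i) //= (proj_id pP (df i)) big1 ?addr0 // => j ji.
by rewrite (proj_neq pP (df j)) // eq_sym.
Qed.

Hypothesis degP : is_grading deg.

Lemma grading_sum i (I : Type) (s : seq I) (Q : pred I) (f : I -> V) :
  (forall k, deg i (f k)) -> deg i (\sum_(k <- s | Q k) f k).
Proof.
have [deg0 degB _ _] := degP => df; elim/big_ind: _ => // u v du dv.
by rewrite -[v]opprK; apply: (degB) => //; rewrite -[- v]add0r; apply: degB.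
Qed.

Lemma grading_neq_sum0 i (I : Type) (s : seq I) (f : I -> V) v :
  deg i v -> v = \sum_(k <- s) f k ->
  (forall k, exists2 j, deg j (f k) & i != j) -> v = 0.
Proof.
move=> dv def_v df; have [p pP] := exists_grading_projection degP.
have p0 : p i 0 = 0 by have [deg0 _ _ _] := degP; rewrite (proj_id pP).
rewrite -(proj_id pP dv) def_v (big_morph _ (projD pP i) p0) big1 // => k _.
by have [j dj ij] := df k; rewrite (proj_neq pP dj).
Qed.

End Gradings.

(** A map that preserves degrees commutes with taking components; the
    component of any preimage is therefore a homogeneous preimage. *)
Lemma grading_preimage (J : eqType) (U V : zmodType) (degU : J -> U -> Prop)
    (degV : J -> V -> Prop) (f : {additive U -> V}) i u v :
  is_grading degU -> is_grading degV ->
  (forall j w, degU j w -> degV j (f w)) -> degV i v -> f u = v ->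
  exists2 w, degU i w & f w = v.
Proof.
move=> degUP degVP df dv def_v.
have [p pP] := exists_grading_projection degUP.
have [q qP] := exists_grading_projection degVP.
exists (p i u); first exact: proj_deg pP i u.
have p0 : p i 0 = 0 by have [deg0 _ _ _] := degUP; rewrite (proj_id pP).
have q0 : q i 0 = 0 by have [deg0 _ _ _] := degVP; rewrite (proj_id qP).
rewrite -(proj_id qP dv) -def_v; have [s _ ->] := proj_sum pP u.
rewrite (big_morph _ (projD pP i) p0) !raddf_sum (big_morph _ (projD qP i) q0).
apply: eq_bigr => j _; have dj := proj_deg pP j u.
have [->|ij] := eqVneq i j.
  by rewrite (proj_id pP dj) (proj_id qP (df _ _ dj)).
by rewrite (proj_neq pP dj ij) (proj_neq qP (df _ _ dj) ij) raddf0.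
Qed.

(** * Free graded modules and their comparison with projective ones *)

Section HomogeneousZero.
Context (F : fieldType) (A : connGradedAlg F).

Lemma cg_deg0 n : cg_deg n (0 : A).
Proof. by have [d0 _ _ _] := cg_grading A. Qed.

Lemma gm_deg0 (M : grMod A) i : gm_deg i (0 : M).
Proof. by have [d0 _ _ _] := gm_grading M. Qed.

End HomogeneousZero.

Section FreeModules.
Context (F : fieldType) (A : connGradedAlg F).
Implicit Types (M N P : grMod A) (I : finType) (a b : A).

Definition int_deg (z : int) a : Prop :=
  if z is Posz n then cg_deg n a else a = 0.

Lemma int_deg0 z : int_deg z 0.
Proof. by case: z => [n|//]; apply: cg_deg0. Qed.

Lemma int_deg_proj : exists p : int -> A -> A,
  grading_projection int_deg p.
Proof.
have [p pP] := exists_grading_projection (cg_grading A).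
exists (fun z a => if z is Posz n then p n a else 0); split.
- by case=> [n|n] a //=; apply: (proj_deg pP).
- by case=> [n|n] a b /=; rewrite ?addr0 // (projD pP).
- by case=> [n|n] a //= da; rewrite (proj_id pP).
- move=> [m|m] [n|n] a //= da; last by rewrite da (proj_id pP) //; apply: cg_deg0.
  by move=> mn; rewrite (proj_neq pP da).
- move=> a; have [s us def_a] := proj_sum pP a; exists (map Posz s).
    by rewrite map_inj_uniq // => m n [].
  by rewrite big_map.
Qed.

Definition free_deg I (d : int) (z : int) (f : {ffun I -> (A^c)^o}) : Prop :=
  forall x, int_deg (z - d) (f x).

Lemma free_grading I d : is_grading (@free_deg I d).
Proof.
have [p pP] := int_deg_proj.
have p0 z : p z 0 = 0 by rewrite (proj_id pP) //; apply: int_deg0.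
apply: (@grading_of_projection _ _ _
  (fun z (f : {ffun I -> (A^c)^o}) => [ffun x => p (z - d) (f x)])).
- by move=> z x; rewrite ffunE; apply: int_deg0.
- move=> z f g df dg x; rewrite !ffunE; move: (df x) (dg x).
  case: (z - d) => [n|n] /= => [|-> ->]; last by rewrite subr0.
  by have [_ dB _ _] := cg_grading A; apply: dB.
split.
- by move=> z f x; rewrite ffunE; apply: (proj_deg pP).
- by move=> z f g; apply/ffunP=> x; rewrite !ffunE (projD pP).
- by move=> z f df; apply/ffunP=> x; rewrite !ffunE (proj_id pP).
- move=> z t f df zt; apply/ffunP=> x; rewrite !ffunE (proj_neq pP (df x)) //.
  by apply: contra_neq zt => /addIr.
move=> f.
have /choice[s sP] : forall x, exists s, uniq s /\ f x = \sum_(z <- s) p z (f x).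
  by move=> x; have [s us def_s] := proj_sum pP (f x); exists s.
pose S := undup (flatten (codom s)).
have p_notin x z : z \notin s x -> p z (f x) = 0.
  move=> z_s; rewrite {}[f x](sP x).2 (big_morph _ (projD pP z) (p0 z)).
  rewrite big_seq big1 // => t t_s; rewrite (proj_neq pP (proj_deg pP t _)) //.
  by apply: contraNneq z_s => ->.
exists (map (+%R d) S); first by rewrite map_inj_uniq ?undup_uniq // => z t /addrI.
apply/ffunP=> x; rewrite big_map sum_ffunE {1}(sP x).2.
have sxS : {subset s x <= S}.
  by move=> z zs; rewrite mem_undup; apply/flattenP; exists (s x) => //; apply: codom_f.
rewrite -(big_uniq_subset _ (sP x).1 (undup_uniq _) sxS).
apply: eq_bigr => z _; rewrite ffunE addrAC subrr add0r.
by case: ifPn => // /p_notin.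
Qed.

Lemma free_act I d i n (f : {ffun I -> (A^c)^o}) a :
  free_deg d i f -> cg_deg n a -> free_deg d (i + n%:Z) ((a : A^c) *: f).
Proof.
move=> df da x; rewrite ffunE; move: (df x).
rewrite addrAC; case: (i - d) => [m|m] /= dfx; first exact: cg_mul dfx da.
by rewrite dfx scaler0; apply: int_deg0.
Qed.

(** The free right module A(-d)^I, generated in degree [d]; right
    multiplication is the scalar action of the converse ring on itself. *)
Definition free_mod I d : grMod A := GrMod (@free_grading I d) (@free_act I d).

Definition free_gen I (x : I) : {ffun I -> (A^c)^o} := [ffun y => (y == x)%:R].

Definition free_lift (M : lmodType A^c) I (m : I -> M)
  (f : {ffun I -> (A^c)^o}) : M := \sum_x (f x : A^c) *: m x.

Fact free_lift_linear (M : lmodType A^c) I (m : I -> M) : linear (free_lift m).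
Proof.
move=> a f g; rewrite /free_lift scaler_sumr -big_split; apply: eq_bigr => x _.
by rewrite !ffunE scalerDl scalerA.
Qed.

HB.instance Definition _ (M : lmodType A^c) I (m : I -> M) :=
  GRing.isLinear.Build A^c {ffun I -> (A^c)^o} M *:%R (free_lift m)
    (free_lift_linear m).

Lemma free_lift_gen (M : lmodType A^c) I (m : I -> M) x :
  free_lift m (free_gen x) = m x.
Proof.
rewrite /free_lift (bigD1 x) //= ffunE eqxx scale1r big1 ?addr0 // => y yx.
by rewrite ffunE (negPf yx) scale0r.
Qed.

Lemma free_sum_gen I (f : {ffun I -> (A^c)^o}) :
  f = \sum_x (f x : A^c) *: free_gen x.
Proof.
apply/ffunP=> y; rewrite sum_ffunE (bigD1 y) //= ffunE ffunE eqxx.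
rewrite big1 ?addr0 => [|x xy]; first by rewrite -[RHS]/(f y * 1 : A^c) mulr1.
by rewrite !ffunE eq_sym (negPf xy) scaler0.
Qed.

Lemma free_linear_eq (M : lmodType A^c) I
    (g h : {linear {ffun I -> (A^c)^o} -> M}) :
  (forall x, g (free_gen x) = h (free_gen x)) -> g =1 h.
Proof.
move=> gh f; rewrite [f]free_sum_gen !linear_sum; apply: eq_bigr => x _.
by rewrite !linearZ gh.
Qed.

Lemma free_gen_deg I d x : gm_deg d (free_gen x : free_mod I d).
Proof.
move=> y; rewrite ffunE subrr; apply/cg_conn; exists (y == x)%:R.
by case: eqP => _; rewrite ?scale1r ?scale0r.
Qed.

Lemma free_lift_deg M I d (m : I -> M) :
  (forall x, gm_deg d (m x)) ->
  deg_preserving (free_lift m : {linear free_mod I d -> M}).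
Proof.
move=> dm i f df; apply: (grading_sum (gm_grading M)) => x.
have := df x; case def_n: (i - d) => [n|n] /= dfx; last first.
  by rewrite dfx scale0r; apply: gm_deg0.
by rewrite -[i](subrK d) def_n addrC; apply: gm_act.
Qed.

Lemma free_generated I d : generated_in d (free_mod I d).
Proof.
move=> f; exists #|I|, (fun j => free_gen (enum_val j)), (fun j => f (enum_val j)).
split=> [j|]; first exact: free_gen_deg.
rewrite [LHS]free_sum_gen.
by rewrite (reindex (@enum_val I I)) //; apply: onW_bij; apply: enum_val_bij.
Qed.

(** The basis lifts to homogeneous elements, and a free module maps anywhere
    its basis does. *)
Lemma free_projective I d : gr_projective (free_mod I d).
Proof.
move=> M N g f dg df surj.
have /choice[m mP] : forall x, exists m, gm_deg d m /\ g m = f (free_gen x).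
  move=> x; have [y gy] := surj (f (free_gen x)).
  have [w dw gw] := grading_preimage (gm_grading M) (gm_grading N) dg
    (df _ _ (free_gen_deg d x)) gy.
  by exists w.
exists (free_lift m : {linear free_mod I d -> M}).
  by apply: free_lift_deg => x; have [] := mP x.
apply: (@free_linear_eq _ _ (g \o free_lift m) f) => x /=.
by rewrite free_lift_gen; have [] := mP x.
Qed.

(** Every element of P is a sum of homogeneous elements of degrees at least
    [d], so its image has no component of degree [i]. *)
Lemma generated_image_low P N (f : {linear P -> N}) i d u v :
  generated_in d P -> deg_preserving f -> gm_deg i u -> (i < d)%R -> f v = u ->
  u = 0.
Proof.
move=> genP df du lt_id def_u; have [k [w [a [dw def_v]]]] := genP v.
have [p pP] := int_deg_proj.
have /choice[s sP] : forall j, exists s, a j = \sum_(z <- s) p z (a j).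
  by move=> j; have [s _ def_s] := proj_sum pP (a j); exists s.
have pt j (z : int) : gm_deg (d + `|z|%N%:Z) (ract (f (w j)) (p z (a j))).
  have := proj_deg pP z (a j); case: z => [n|n] /= dp; first by apply: gm_act dp; apply: df.
  by rewrite dp /ract scale0r; apply: gm_deg0.
suff sum_u : u = \sum_(jz <- [seq (j, z) | j <- enum 'I_k, z <- s j])
    ract (f (w jz.1)) (p jz.2 (a jz.1)).
  apply: (grading_neq_sum0 (gm_grading N) du sum_u) => -[j z].
  by exists (d + `|z|%N%:Z) => //=; lia.
rewrite -def_u def_v linear_sum big_allpairs_dep /= big_enum; apply: eq_bigr => j _.
rewrite linearZ /= [in LHS](sP j) /ract.
rewrite (big_morph (fun b : A => (b : A^c) *: f (w j)) (id1 := 0) (op1 := +%R)) //.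
  by move=> b c; apply: scalerDl.
exact: scale0r.
Qed.

(** Uniqueness of the minimal cover.  The lift of [dQ] through [dP] is
    bijective in degree [d], the degree of the generators on both sides: it is
    therefore onto, it splits because P is projective, and the splitting is a
    two-sided inverse since it is one on the basis. *)
Lemma free_comparison I d P N (dQ : {linear free_mod I d -> N})
    (dP : {linear P -> N}) :
  gr_projective P -> generated_in d P -> deg_preserving dQ -> deg_preserving dP ->
  (forall q, exists p, dP p = dQ q) ->
  (forall u, gm_deg d u -> exists q, dQ q = dP u) ->
  (forall q, gm_deg d q -> dQ q = 0 -> q = 0) ->
  (forall u, gm_deg d u -> dP u = 0 -> u = 0) ->
  exists f : {linear free_mod I d -> P},
    [/\ deg_preserving f, injective f, forall p, exists q, f q = p
      & forall q, dP (f q) = dQ q].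
Proof.
move=> projP genP degQ degP QP PQ injQ injP.
have /choice[m mP] : forall x, exists m, gm_deg d m /\ dP m = dQ (free_gen x).
  move=> x; have [y gy] := QP (free_gen x).
  have [w dw gw] := grading_preimage (gm_grading P) (gm_grading N) degP
    (degQ _ _ (free_gen_deg d x)) gy.
  by exists w.
pose f : {linear free_mod I d -> P} := free_lift m.
have df : deg_preserving f by apply: free_lift_deg => x; have [] := mP x.
have fP q : dP (f q) = dQ q.
  apply: (@free_linear_eq _ _ (dP \o f) dQ) => x /=.
  by rewrite [f _]free_lift_gen; have [] := mP x.
have dB : forall i (u v : P), gm_deg i u -> gm_deg i v -> gm_deg i (u - v).
  by have [_ dB _ _] := gm_grading P.
have surj_d u : gm_deg d u -> exists q, f q = u.
  move=> du; have [q def_q] := PQ u du.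
  have [w dw def_w] := grading_preimage (gm_grading (free_mod I d)) (gm_grading N) degQ
    (degP _ _ du) def_q.
  exists w; apply/eqP; rewrite -subr_eq0; apply/eqP/injP.
    by apply: dB => //; apply: df.
  by rewrite linearB [dP (f w)]fP def_w subrr.
have surj p : exists q, f q = p.
  have [k [u [a [du ->]]]] := genP p.
  have /choice[q qP] : forall j, exists q, f q = u j by move=> j; apply: surj_d.
  exists (\sum_j ract (q j) (a j)); rewrite linear_sum; apply: eq_bigr => j _.
  by rewrite linearZ /= qP.
have [g dg gP] := projP (free_mod I d) P f idfun df (fun _ _ h => h) surj.
have gf : cancel f g.
  apply: (@free_linear_eq _ _ (g \o f) idfun) => x /=.
  have dx := free_gen_deg d x.
  apply/eqP; rewrite -subr_eq0; apply/eqP/injQ.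
    have [_ dB' _ _] := gm_grading (free_mod I d).
    by apply: dB' => //; apply/dg/df.
  by rewrite linearB -!fP gP subrr.
by exists f; split=> //; apply: can_inj gf.
Qed.

End FreeModules.

(** * A linear complex of free modules indexed by paths *)

Section PathCriterion.
Context (F : fieldType) (A : connGradedAlg F) (J : finType).
Context (b : J -> A) (K : option J -> pred J).

(** The coordinates that a cycle may have at a path with last element [o].
    The empty path stands for the unit of the algebra, which maps to the trivial
    module, so there the augmentation ideal replaces the annihilator. *)
Definition ann (o : option J) (a : A) : Prop :=
  if o is Some j then b j * a = 0 else a \in @irrelevant F A.

Definition spanned (o : option J) (a : A) : Prop :=
  exists c : J -> A, a = \sum_(k | K o k) b k * c k.

(** A path is a sequence of indices in which each is allowed by [K] to follow
    its predecessor; the type and the last element are defined together since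
    the former at one length depends on the latter at the previous one. *)
Fixpoint path_type (i : nat) : {I : finType & I -> option J} :=
  if i is i'.+1 then
    existT (fun I : finType => I -> option J)
      {p : projT1 (path_type i') * J | K (projT2 (path_type i') p.1) p.2}
      (fun p => Some (val p).2)
  else existT (fun I : finType => I -> option J) unit (fun=> None).

Definition paths i : finType := projT1 (path_type i).
Definition plast i : paths i -> option J := projT2 (path_type i).

Definition path_init i (p : paths i.+1) : paths i := (val p).1.
Definition path_end i (p : paths i.+1) : J := (val p).2.

Lemma path_endP i (p : paths i.+1) : K (plast (path_init p)) (path_end p).
Proof. exact: (valP p). Qed.

Lemma exists_path_rcons i (p : paths i) k : K (plast p) k ->
  exists2 p' : paths i.+1, path_init p' = p & path_end p' = k.
Proof. by move=> pk; exists (exist _ (p, k) pk). Qed.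

Local Notation Q i := (free_mod A (paths i) i%:Z).

Definition path_diff i : {linear Q i.+1 -> Q i} :=
  free_lift (fun p' : paths i.+1 =>
    ([ffun p => if p == path_init p' then b (path_end p') else 0] : Q i)).

Lemma path_diffE i (z : Q i.+1) (p : paths i) :
  path_diff i z p = \sum_(p' | path_init p' == p) b (path_end p') * z p'.
Proof.
rewrite sum_ffunE [RHS]big_mkcond; apply: eq_bigr => p' _.
rewrite !ffunE eq_sym; case: ifP => _ //; exact: scaler0.
Qed.

Lemma sum_paths i (p : paths i) (g : paths i.+1 -> A) (c : J -> A) :
  (forall p', path_init p' = p -> g p' = c (path_end p')) ->
  \sum_(p' | path_init p' == p) g p' = \sum_(k | K (plast p) k) c k.
Proof.
move=> gc; rewrite (reindex_omap (@path_end i) (fun k => insub (p, k))) /=; last first.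
  by move=> k pk; rewrite insubT.
apply: eq_big => [p'|p' /eqP/gc//].
apply/eqP/andP=> [<-|[pk /eqP]].
  split; first exact: path_endP.
  by apply/eqP; case: p' => -[q k] qk; rewrite /path_init /path_end /= insubT.
by rewrite insubT => -[<-].
Qed.

Lemma image_path_diff i (z : Q i) :
  (exists z', z = path_diff i z') <-> forall p, spanned (plast p) (z p).
Proof.
split=> [[z' ->] p|/choice[c zc]].
  exists (fun k => \sum_(p' | (path_init p' == p) && (path_end p' == k)) z' p').
  rewrite path_diffE; apply: sum_paths => p' <-; congr (_ * _).
  by rewrite (big_pred1 p').
exists [ffun p' => c (path_init p') (path_end p')]; apply/ffunP=> p.
by rewrite path_diffE zc; apply/esym/sum_paths => p' <-; rewrite ffunE.
Qed.

Hypothesis b_deg : forall j, cg_deg 1 (b j).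
Hypothesis direct : forall o (c : J -> A),
  \sum_(k | K o k) b k * c k = 0 -> forall k, K o k -> b k * c k = 0.

(** The coordinate of the boundary at a path p is a sum over the
    continuations of p, and independence of the right ideals generated by these
    makes each summand vanish separately. *)
Lemma kernel_path_diff i (z : Q i.+1) :
  path_diff i z = 0 <-> forall p, ann (plast p) (z p).
Proof.
split=> [dz0 p'|zp].
  pose p := path_init p'; pose c k :=
    \sum_(q | (path_init q == p) && (path_end q == k)) z q.
  have := congr1 (fun f : Q i => f p) dz0; rewrite /= path_diffE ffunE.
  rewrite (@sum_paths _ _ _ (fun k => b k * c k)) => [|q def_p]; last first.
    by congr (_ * _); rewrite /c -def_p (big_pred1 q).
  have cE : c (path_end p') = z p' by rewrite /c (big_pred1 p').
  by move/direct/(_ _ (path_endP p')); rewrite cE.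
by apply/ffunP=> p; rewrite path_diffE ffunE big1 // => p' _; apply: zp.
Qed.

Lemma path_diff_deg i : deg_preserving (path_diff i).
Proof.
apply: free_lift_deg => p' p; rewrite ffunE.
have -> : i.+1%:Z - i%:Z = 1%:Z by lia.
by case: eqP => _; [apply: b_deg|apply: cg_deg0].
Qed.

Definition triv1 : trivial_mod A := \pi_(trivial_sort A)%qT 1.

Definition path_aug : {linear Q 0 -> trivial_mod A} := free_lift (fun=> triv1).

Lemma path_augE (z : Q 0) : path_aug z = \pi_(trivial_sort A)%qT (z tt : A).
Proof.
rewrite /= /free_lift (big_pred1 tt) => [|[]//].
by rewrite [LHS]trivial_scaleE mul1r.
Qed.

Lemma path_aug_deg : deg_preserving path_aug.
Proof. by apply: free_lift_deg => _; left. Qed.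

Lemma kernel_path_aug (z : Q 0) :
  path_aug z = 0 <-> forall p, ann (plast p) (z p).
Proof.
have pi0 (a : A) : \pi_(trivial_sort A)%qT a = 0 <-> a \in @irrelevant F A.
  rewrite -[X in _ = X](raddf0 (\pi_(trivial_sort A)%qT)).
  by rewrite (trivial_piB a 0) subr0.
rewrite path_augE pi0; split=> [? []//|h]; exact: (h tt).
Qed.

Hypothesis b_neq0 : forall j, b j != 0.
Hypothesis complex : forall o a, spanned o a -> ann o a.
Hypothesis strand : forall o a, cg_deg 1 a -> ann o a -> spanned o a.

(** No nonzero scalar annihilates a nonzero element or lies in the
    augmentation ideal; this makes the differentials injective on generators. *)
Lemma ann_deg0 i (p : paths i) a : cg_deg 0 a -> ann (plast p) a -> a = 0.
Proof.
move=> /cg_conn[c ->]; case: (plast p) => [j|] /=.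
  rewrite mulr_algr => /eqP; rewrite scaler_eq0 (negPf (b_neq0 j)) orbF.
  by move=> /eqP->; rewrite scale0r.
move=> /asboolP[k [f [df sum_f]]].
apply: (grading_neq_sum0 (cg_grading A) (i := 0%N) _ sum_f).
  by apply/cg_conn; exists c.
by move=> n; exists n.+1.
Qed.

Lemma spannedD o a a' : spanned o a -> spanned o a' -> spanned o (a + a').
Proof.
move=> [c ->] [c' ->]; exists (fun k => c k + c' k).
by rewrite -big_split; apply: eq_bigr => k _; rewrite mulrDr.
Qed.

Lemma spannedM o a a' : spanned o a -> spanned o (a * a').
Proof.
move=> [c ->]; exists (fun k => c k * a').
by rewrite mulr_suml; apply: eq_bigr => k _; rewrite mulrA.
Qed.

Lemma spanned0 o : spanned o 0.
Proof. by exists (fun=> 0); rewrite big1 // => k _; rewrite mulr0. Qed.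

(** Exactness of the complex of paths, read off coordinate by coordinate. *)
Definition path_exact : Prop :=
  forall i (p : paths i) a, ann (plast p) a -> spanned (plast p) a.

Lemma koszul_of_path_exact : path_exact -> koszul A.
Proof.
move=> ex; exists (fun i => Q i), path_diff, path_aug; split.
- by move=> i; apply: free_projective.
- by move=> i; apply: free_generated.
- exact: path_diff_deg.
- exact: path_aug_deg.
- elim/quotW=> a; exists ([ffun=> a] : Q 0).
  by rewrite path_augE ffunE.
- move=> z; rewrite kernel_path_aug image_path_diff.
  by split=> h p; [apply: ex|apply: complex].
move=> i z; rewrite kernel_path_diff image_path_diff.
by split=> h p; [apply: ex|apply: complex].
Qed.

(** By induction on i there is an isomorphism from the i-th term of the
    complex to that of the given linear resolution which matches the cycles.
    Cycles of the resolution are generated in degree i + 1, where those of the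
    complex are boundaries by [strand]; hence all its cycles are boundaries.
    That both kinds of cycles agree in degree i + 1 is also what
    [free_comparison] needs for the next term. *)
Lemma path_exact_of_koszul : koszul A -> path_exact.
Proof.
move=> [P [d [e [projP genP dd de surj_e ex0 exS]]]].
(* The cycles of P; at the end the augmentation takes over from d. *)
pose kerP i : P i -> Prop :=
  match i with 0%N => fun p => e p = 0 | i'.+1 => fun p => d i' p = 0 end.
have kerPE i (p : P i) : kerP i p <-> exists q, p = d i q.
  by case: i p => [|i] p; [apply: ex0|apply: exS].
have ker_deg0 i (u : P i) : gm_deg i%:Z u -> kerP i u -> u = 0.
  move=> du /kerPE[v def_u].
  apply: (generated_image_low (genP i.+1) (dd i) du _ (esym def_u)); lia.
suff compare i : exists f : {linear Q i -> P i},
    [/\ deg_preserving f, injective f, forall p, exists q, f q = p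
      & forall z, kerP i (f z) <-> forall p, ann (plast p) (z p)].
  move=> i p a pa; have [f [df inj_f surj_f kerf]] := compare i.
  pose z : Q i := [ffun q => if q == p then a else 0].
  have ann0 o : ann o 0 by apply: complex; apply: spanned0.
  have [q fz] : exists q, f z = d i q.
    by apply/kerPE/kerf => q; rewrite ffunE; case: eqP => [->|].
  have [k [u [c [du def_q]]]] := genP i.+1 q.
  have /choice[w wP] : forall j, exists w : Q i,
      [/\ forall p, spanned (plast p) (w p) & f w = d i (u j)].
    move=> j; have [w def_w] := surj_f (d i (u j)).
    have [w' dw' def_w'] := grading_preimage (gm_grading (Q i))
      (gm_grading (P i)) df (dd i _ _ (du j)) def_w.
    exists w'; split=> // r; apply: strand.
      by have := dw' r; rewrite (_ : i.+1%:Z - i%:Z = 1%:Z) //; lia.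
    by move: r; apply/kerf/kerPE; exists (u j).
  have def_z : z = \sum_j ract (w j) (c j).
    apply: inj_f; rewrite fz def_q !linear_sum; apply: eq_bigr => j _.
    by rewrite !linearZ /= (wP j).2.
  have -> : a = z p by rewrite ffunE eqxx.
  rewrite def_z sum_ffunE; elim/big_ind: _ => [|x y|j _].
  + exact: spanned0.
  + exact: spannedD.
  by rewrite ffunE; apply: spannedM; have [] := wP j.
elim: i => [|i [f [df inj_f surj_f kerf]]].
  have [q|u du|q dq|u du|f [df inj_f surj_f def_f]] :=
      free_comparison (projP 0%N) (genP 0%N) path_aug_deg de.
  - exact: surj_e.
  - move: (e u); elim/quotW=> a; exists ([ffun=> a] : Q 0).
    by rewrite path_augE ffunE.
  - move=> /kernel_path_aug q0; apply/ffunP=> p; rewrite ffunE.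
    by apply: (ann_deg0 (p := p)) (q0 p); apply: (dq p).
  - exact: (ker_deg0 0%N).
  exists f; split=> // z; rewrite /= def_f; exact: kernel_path_aug.
have [|q|u du|q dq|u du|g [dg inj_g surj_g def_g]] :=
    free_comparison (dQ := f \o path_diff i) (projP i.+1) (genP i.+1) _ (dd i).
- by move=> t m dm /=; apply/df/path_diff_deg.
- have /kerPE[p def_p] : kerP i (f (path_diff i q)).
    apply/kerf => p; apply: complex; move: p; apply/image_path_diff.
    by exists q.
  by exists p; rewrite -def_p.
- have [w def_w] := surj_f (d i u).
  have [w' dw' def_w'] := grading_preimage (gm_grading (Q i))
    (gm_grading (P i)) df (dd i _ _ du) def_w.
  have /image_path_diff[q def_q] : forall p, spanned (plast p) (w' p).
    move=> r; apply: strand.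
      by have := dw' r; rewrite (_ : i.+1%:Z - i%:Z = 1%:Z) //; lia.
    by move: r; apply/kerf/kerPE; exists u.
  by exists q; rewrite /= -def_q.
- move=> fq0; have /kernel_path_diff q0 : path_diff i q = 0.
    by apply: inj_f; rewrite linear0.
  apply/ffunP=> p; rewrite ffunE.
  by apply: (ann_deg0 (p := p)) (q0 p); have := dq p; rewrite subrr.
- exact: (ker_deg0 i.+1).
exists g; split=> // z; rewrite /= def_g -kernel_path_diff /=.
split=> [fz0|->]; last by rewrite linear0.
by apply: inj_f; rewrite linear0.
Qed.

End PathCriterion.

(** * The splitting algebra by generators and relations *)

Section UniversalProperty.
Context (F : fieldType) (G : layeredGraph) (B : nzRingType).
Context (f : {rmorphism F -> B}) (h : nonbot G -> B).
Hypothesis f_central : forall c b, f c * b = b * f c.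
Hypothesis h_mul : forall x y : nonbot G, val y \notin lower (val x) 1 ->
  h x * h y = 0.
Hypothesis h_sum : forall x : nonbot G, (1 < lg_rk (val x))%N ->
  h x * (\sum_(y : nonbot G | val y \in lower (val x) 1) h y) = 0.

Definition eval_word (w : {fmonom (nonbot G)}) : B :=
  \prod_(x <- fmonom_val w) h x.

Fact eval_word_mmorphism : mmorphism eval_word.
Proof.
split; last by rewrite /eval_word fm1 big_nil.
by move=> u v; rewrite /eval_word fmM big_cat.
Qed.
HB.instance Definition _ :=
  isMultiplicative.Build {fmonom (nonbot G)} B eval_word eval_word_mmorphism.

Definition eval_tensor : tensorAlg F G -> B := mmap f eval_word.

Lemma eval_tensorM a b : eval_tensor (a * b) = eval_tensor a * eval_tensor b.
Proof. by apply: (commr_mmap_is_multiplicative _).1 => g m m'; apply: f_central. Qed.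

Lemma eval_tensorD a b : eval_tensor (a + b) = eval_tensor a + eval_tensor b.
Proof. exact: mmapD. Qed.

Lemma eval_tensor0 : eval_tensor 0 = 0.
Proof. exact: mmap0. Qed.

Lemma eval_tgen x : eval_tensor (tgen F x) = h x.
Proof.
rewrite /eval_tensor mmapU /eval_word fmU big_seq1 -[RHS]mul1r.
by congr (_ * _); apply: rmorph1.
Qed.

Lemma eval_ideal a : ideal_gen (@relator F G) a -> eval_tensor a = 0.
Proof.
elim=> {a} [_ [x y nyx|x]||a b _ ha _ hb|c a _ ha|a c _ ha].
- by rewrite eval_tensorM !eval_tgen h_mul.
- rewrite eval_tensorM eval_tgen /tgen_sum; case: ifP => [rk_x|_].
    rewrite (big_morph _ eval_tensorD eval_tensor0).
    by under eq_bigr do rewrite eval_tgen; exact: h_sum.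
  by rewrite eval_tensor0 mulr0.
- exact: eval_tensor0.
- by rewrite eval_tensorD ha hb addr0.
- by rewrite eval_tensorM ha mulr0.
- by rewrite eval_tensorM ha mul0r.
Qed.

(** The target is a ring with a central ring morphism from F, so that matrix
    rings over R(Gamma) itself qualify, with the scalar matrices. *)
Lemma splitAlg_lift : exists phi : splitAlg F G -> B,
  [/\ forall x, phi (rgen F x) = h x, phi 1 = 1,
      forall a b, phi (a + b) = phi a + phi b,
      forall a b, phi (a * b) = phi a * phi b
    & forall c a, phi (c *: a) = f c * phi a].
Proof.
pose phi (r : splitAlg F G) := eval_tensor (repr r).
have phiE a : phi (split_pi a) = eval_tensor a.
  rewrite -[RHS]add0r -(eval_ideal (split_reprE a)) /phi -eval_tensorD.
  by rewrite subrK.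
exists phi; split=> [x||a b|a b|c a]; first by rewrite phiE eval_tgen.
- by rewrite [LHS]phiE; apply: mmap1.
- elim/split_piW: a => a; elim/split_piW: b => b.
  by rewrite -split_piD !phiE eval_tensorD.
- elim/split_piW: a => a; elim/split_piW: b => b.
  by rewrite -split_piM !phiE eval_tensorM.
- by elim/split_piW: a => a; rewrite -split_piZ !phiE /eval_tensor mmapZ.
Qed.

End UniversalProperty.

(** The relations, generation in degree 1 and the universal property determine
    R(Gamma) up to isomorphism.  Arguing from them alone keeps the ideal of
    relations out of sight. *)
Record split_presentation (F : fieldType) (G : layeredGraph)
    (R : connGradedAlg F) (r : nonbot G -> R) : Prop := SplitPresentation {
  sp_mul0 : forall x y : nonbot G, val y \notin lower (val x) 1 ->
    r x * r y = 0;
  sp_mul_sum : forall x : nonbot G, (1 < lg_rk (val x))%N ->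
    r x * (\sum_(y : nonbot G | val y \in lower (val x) 1) r y) = 0;
  sp_deg : forall x, cg_deg 1 (r x);
  sp_degS : forall n (a : R), cg_deg n.+1 a ->
    exists c : nonbot G -> R, (forall x, cg_deg n (c x)) /\
      a = \sum_x r x * c x;
  sp_lift : forall (B : nzRingType) (f : {rmorphism F -> B})
      (h : nonbot G -> B),
    (forall c b, f c * b = b * f c) ->
    (forall x y : nonbot G, val y \notin lower (val x) 1 -> h x * h y = 0) ->
    (forall x : nonbot G, (1 < lg_rk (val x))%N ->
      h x * (\sum_(y : nonbot G | val y \in lower (val x) 1) h y) = 0) ->
    exists phi : R -> B,
      [/\ forall x, phi (r x) = h x, phi 1 = 1,
          forall a b, phi (a + b) = phi a + phi b,
          forall a b, phi (a * b) = phi a * phi b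
        & forall c a, phi (c *: a) = f c * phi a]
}.

Section SplittingAlgebraTheory.
Context (F : fieldType) (G : layeredGraph).
Implicit Types x y z : nonbot G.
Local Notation R := (splitAlg F G).

Lemma rgen_sumE x n : rgen_sum F x n =
  if (n < lg_rk (val x))%N then
    \sum_(y : nonbot G | val y \in lower (val x) n) rgen F y else 0.
Proof.
by rewrite /rgen_sum /tgen_sum; case: ifP; rewrite ?split_pi_sum ?split_pi0.
Qed.

Lemma rgen_mul0 x y : val y \notin lower (val x) 1 -> rgen F x * rgen F y = 0.
Proof.
by move=> nyx; rewrite -split_piM; apply/split_pi_eq0/Ideal_gen; constructor.
Qed.

Lemma rgen_mul_sum x : rgen F x * rgen_sum F x 1 = 0.
Proof. by rewrite -split_piM; apply/split_pi_eq0/Ideal_gen; constructor. Qed.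

Lemma rgen_deg x : cg_deg 1 (rgen F x).
Proof. by exists (tgen F x) => //; apply: homogen_tgen. Qed.

Lemma tensor_word_cons x (w : seq (nonbot G)) :
  << FMonom (x :: w) >> = tgen F x * << FMonom w >> :> tensorAlg F G.
Proof.
rewrite [RHS]fgmulUU mulr1; congr << _ >>.
by rewrite /mmul /mul /= fmmulE fmuE.
Qed.

Lemma tensor_monomE (c : F) (m : {fmonom (nonbot G)}) :
  << c *g m >> = c *: << m >> :> tensorAlg F G.
Proof. by apply/malgP=> k; rewrite mcoeffZ !mcoeffU mulr_natr. Qed.

(** A word of positive length has a first letter. *)
Lemma split_degS n (a : R) : cg_deg n.+1 a ->
  exists c : nonbot G -> R, (forall x, cg_deg n (c x)) /\
    a = \sum_x rgen F x * c x.
Proof.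
case=> t ht ->.
pose D (r : R) := exists c : nonbot G -> R,
  (forall x, cg_deg n (c x)) /\ r = \sum_x rgen F x * c x.
rewrite -/(D _) [t]monalgE split_pi_sum big_seq.
elim/big_ind: _ => [|_ _ [c [dc ->]] [e [de ->]]|m m_t].
- exists (fun=> 0); split; first by move=> *; apply: cg_deg0.
  by rewrite big1 // => x _; rewrite mulr0.
- exists (fun x => c x + e x); split; first by move=> x; apply: cg_degD.
  by rewrite -big_split; apply: eq_bigr => x _; rewrite mulrDr.
have := ht m; rewrite mcoeff_neq0 => /(_ m_t).
case: m {m_t} => -[|y w] //= [size_w].
exists (fun x => if x == y
  then split_pi (mcoeff (FMonom (y :: w)) t *: << FMonom w >>) else 0).
split=> [x|].
  case: eqP => _; last by exact: (@cg_deg0 F R n).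
  eexists; last by []; apply: homogenZ => m; rewrite mcoeffU1.
  by case: (eqVneq (FMonom w) m) => [<- _ //|_]; rewrite eqxx.
rewrite (bigD1 y) //= eqxx big1 ?addr0 => [|x /negPf->]; last by rewrite mulr0.
by rewrite tensor_monomE tensor_word_cons tensor_scaleAr split_piM.
Qed.

Lemma splitAlg_presentation : split_presentation (@rgen F G).
Proof.
split.
- exact: rgen_mul0.
- by move=> x rk_x; rewrite -[RHS](rgen_mul_sum x) rgen_sumE rk_x.
- exact: rgen_deg.
- exact: split_degS.
- by move=> B f h; apply: splitAlg_lift.
Qed.

End SplittingAlgebraTheory.

(** * Consequences of the presentation *)

Section PresentedAlgebra.
Context (F : fieldType) (G : layeredGraph) (R : connGradedAlg F).
Context (r : nonbot G -> R) (rP : split_presentation r).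
Implicit Types x y z : nonbot G.

Lemma gen_ind (P : R -> Prop) :
  P 1 -> (forall (c : F) a b, P a -> P b -> P (c *: a + b)) ->
  (forall a b, P a -> P b -> P (a * b)) -> (forall x, P (r x)) ->
  forall a, P a.
Proof.
move=> P1 PZ PM Pgen; apply: (@cg_gen1 _ R P P1 PZ PM) => a /(sp_degS rP)[c [dc ->]].
have P0 : P 0 by rewrite -(addNr (1 : R)) -scaleN1r; apply: PZ.
elim/big_rec: _ => // x b _ Pb; have [e ce] := (cg_conn (c x)).1 (dc x).
by rewrite ce mulr_algr; apply: PZ.
Qed.

(** Projection to the summand r_x R is the (epsilon, id)-derivation D with
    D(r_y) = r_x for y = x and 0 otherwise, and such a derivation is the same as
    a ring morphism to triangular matrices with rows (epsilon, D) and (0, id).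
    It respects the relations because each of them begins with one generator. *)
Lemma gen_direct (a : nonbot G -> R) :
  \sum_x r x * a x = 0 -> forall x, r x * a x = 0.
Proof.
move=> sum0 x; pose f : {rmorphism F -> 'M[R]_2} := @scalar_mx R 2 \o in_alg R.
pose sel (u : nonbot G) (i : 'I_2) : R :=
  if i == 0 then if u == x then r x else 0 else r u.
pose h (u : nonbot G) : 'M[R]_2 :=
  \matrix_(i, j) if j == 0 then 0 else sel u i.
have hM u (M : 'M[R]_2) i j : (h u * M) i j = sel u i * M 1 j.
  rewrite mxE !big_ord_recl big_ord0 !mxE /= mul0r add0r addr0.
  by congr (_ * M _ _); apply/val_inj.
have fM c M : f c * M = c%:A *: M by exact: mul_scalar_mx.
have sel_mul0 u i b : r u * b = 0 -> sel u i * b = 0.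
  by rewrite /sel; case: ifP => // _; case: eqP => [<-//|]; rewrite mul0r.
have [|u v uv|u rk_u|phi [phi_gen phi1 phiD phiM phiZ]] := sp_lift rP (f := f) (h := h).
- move=> c M; apply/matrixP=> i j; rewrite fM mxE.
  rewrite mxE (bigD1 j) //= big1 => [|k /negPf kj]; last first.
    by rewrite !mxE kj mulr0.
  by rewrite !mxE eqxx addr0 mulr_algl mulr_algr.
- apply/matrixP=> i j; rewrite hM [RHS]mxE mxE /=; case: ifP; rewrite ?mulr0 // => _.
  by apply: sel_mul0; exact: (sp_mul0 rP uv).
- apply/matrixP=> i j; rewrite hM summxE [RHS]mxE; apply: sel_mul0.
  have [->|j0] := eqVneq j 0.
    by rewrite big1 ?mulr0 // => v _; rewrite mxE eqxx.
  rewrite -[RHS](sp_mul_sum rP rk_u); congr (_ * _).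
  by apply: eq_bigr => v _; rewrite mxE (negPf j0).
have phi0 : phi 0 = 0.
  by rewrite -(addNr (1 : R)) -scaleN1r phiD phiZ rmorphN1 mulN1r addNr.
have phi_id b : phi b 1 0 = 0 /\ phi b 1 1 = b.
  elim/gen_ind: b => [|c a1 b [a10 a11] [b10 b11]|a1 b [a10 a11] [b10 b11]|u].
  - by rewrite phi1 !mxE.
  - by rewrite phiD phiZ fM !mxE a10 a11 b10 b11 mulr0 addr0 mulr_algl.
  - rewrite phiM !mxE !big_ord_recl !big_ord0.
    have -> : lift ord0 ord0 = 1 :> 'I_2 by apply: val_inj.
    by rewrite a10 a11 b10 b11 !(mul0r, mulr0, add0r, addr0).
  - by rewrite phi_gen !mxE.
have : phi (\sum_y r y * a y) 0 1 = 0 by rewrite sum0 phi0 mxE.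
rewrite (big_morph phi phiD phi0) summxE (bigD1 x) //= big1 => [|y yx].
  by rewrite phiM phi_gen hM (phi_id _).2 addr0 /sel !eqxx.
by rewrite phiM phi_gen hM /sel (negPf yx) /= mul0r.
Qed.

(** In degree 2, the only relation between the r_x r_v with v in S_x(1) is
    r_x r_x(1) = 0.  This is detected by a representation by strictly triangular
    3 x 3 matrices in which r_x r_v has corner entry psi(v), where psi is the
    difference of the coordinate functions at z and z'.  The relations hold since
    psi vanishes outside S_x(1) and has sum 0 over it. *)
Lemma gen_mul_const x (c : nonbot G -> F) :
  r x * (\sum_z c z *: r z) = 0 ->
  forall z z', val z \in lower (val x) 1 -> val z' \in lower (val x) 1 ->
  c z = c z'.
Proof.
move=> rel0 z z' zx z'x; have [->//|ne_zz'] := eqVneq z z'.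
pose psi u : F := (u == z)%:R - (u == z')%:R.
have psi0 u : val u \notin lower (val x) 1 -> psi u = 0.
  by move=> ux; rewrite /psi !(negPf (contraNneq _ ux)) ?subrr // => ->.
pose i2 : 'I_3 := inord 2.
have ne21 : (i2 == 1 :> 'I_3) = false by rewrite -val_eqE /= inordK.
have ne20 : (i2 == 0 :> 'I_3) = false by rewrite -val_eqE /= inordK.
pose h u : 'M[F]_3 := (u == x)%:R *: delta_mx 0 1 + psi u *: delta_mx 1 i2.
have hM u v : h u * h v = ((u == x)%:R * psi v) *: delta_mx 0 i2.
  change (h u *m h v = ((u == x)%:R * psi v) *: delta_mx 0 i2).
  rewrite mulmxDl !mulmxDr -!scalemxAl -!scalemxAr !mul_delta_mx_cond.
  rewrite eqxx ne21 ne20 /=.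
  by rewrite !(mulr0n, mulr1n, scaler0, addr0, add0r) scalerA.
have [|u v uv|u rk_u|phi [phi_gen _ phiD phiM phiZ]] :=
    sp_lift rP (f := @scalar_mx F 3) (h := h).
- by move=> e M; exact: (esym (scalar_mxC e M)).
- rewrite hM; have [eux|_] := eqVneq u x; last by rewrite mul0r scale0r.
  by rewrite psi0 ?mulr0 ?scale0r // -eux.
- rewrite mulr_sumr (eq_bigr _ (fun v _ => hM u v)) -scaler_suml -mulr_sumr.
  have [->|_] := eqVneq u x; last by rewrite mul0r scale0r.
  rewrite big_mkcond (eq_bigr psi) => [|v _]; last first.
    by case: ifP => // /negbT/psi0.
  have sum1 t : \sum_v (v == t)%:R = 1 :> F.
    by rewrite (bigD1 t) //= eqxx big1 ?addr0 // => v /negPf->.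
  by rewrite sumrB !sum1 subrr mulr0 scale0r.
have phi0 : phi 0 = 0.
  by rewrite -(addNr (1 : R)) -scaleN1r phiD phiZ rmorphN1 mulN1r addNr.
have : phi (r x * (\sum_z c z *: r z)) 0 i2 = 0 by rewrite rel0 phi0 mxE.
rewrite phiM (big_morph phi phiD phi0) phi_gen mulr_sumr summxE.
rewrite (eq_bigr (fun u => c u * psi u)) => [|u _]; last first.
  have -> : phi (c u *: r u) = c u *: h u.
    by rewrite phiZ phi_gen; exact: mul_scalar_mx.
  have -> : h x * (c u *: h u) = c u *: (h x * h u) by rewrite scalerAr.
  by rewrite hM eqxx mul1r !mxE !eqxx mulr1.
have sumd t : \sum_v c v * (v == t)%:R = c t.
  rewrite (bigD1 t) //= eqxx mulr1 big1 ?addr0 // => v /negPf->.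
  by rewrite mulr0.
under eq_bigr do rewrite mulrBr.
by rewrite sumrB !sumd => /eqP; rewrite subr_eq0 => /eqP.
Qed.

Lemma gen_neq0 x : r x != 0.
Proof.
pose h u : 'M[F]_2 := (u == x)%:R *: delta_mx 0 1.
have hM u v : h u * h v = 0.
  change (h u *m h v = 0); rewrite -scalemxAl -scalemxAr mul_delta_mx_0 //.
  by rewrite !scaler0.
have [|u v uv|u rk_u|phi [phi_gen _ phiD phiM phiZ]] :=
    sp_lift rP (f := @scalar_mx F 2) (h := h).
- by move=> e M; exact: (esym (scalar_mxC e M)).
- exact: hM.
- by rewrite mulr_sumr big1.
have phi0 : phi 0 = 0.
  by rewrite -(addNr (1 : R)) -scaleN1r phiD phiZ rmorphN1 mulN1r addNr.
apply/eqP=> rx0; have := phi_gen x; rewrite rx0 phi0 => /matrixP/(_ 0 1).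
by rewrite !mxE !eqxx mulr1 => /eqP; rewrite eq_sym oner_eq0.
Qed.

End PresentedAlgebra.

(** * Annihilators of the sums over a level *)

Section SplitCriterion.
Context (F : fieldType) (G : layeredGraph) (R : connGradedAlg F).
Context (r : nonbot G -> R) (rP : split_presentation r).
Implicit Types (x y z : nonbot G) (a : R).

(** The element r_x(n); for n at least rk x the sum is empty, because its index
    ranges over elements other than the bottom. *)
Definition gen_sum x n : R := \sum_(y : nonbot G | val y \in lower (val x) n) r y.

Lemma gen_sum0 x : gen_sum x 0 = r x.
Proof.
by rewrite /gen_sum (big_pred1 x) // => y; rewrite lower0 (inj_eq val_inj).
Qed.

Lemma gen_mul_sum x : r x * gen_sum x 1 = 0.
Proof.
have [/(sp_mul_sum rP)//|le_x1] := ltnP 1 (lg_rk (val x)).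
by rewrite /gen_sum big_pred0 ?mulr0 // => y; apply: lower_empty.
Qed.

(** Independence of the right ideals attached to S_x(m) is brought back to
    that of the r_y R by collecting coefficients. *)
Lemma gen_sum_combination x m (e : R) (c : nonbot G -> R) :
  gen_sum x m * e + \sum_(y : nonbot G | val y \notin lower (val x) m) r y * c y =
  \sum_y r y * (if val y \in lower (val x) m then e else c y).
Proof.
rewrite mulr_suml [RHS](bigID (fun y => val y \in lower (val x) m)) /=.
by congr (_ + _); apply: eq_bigr => y; [move=> ->|move=> /negPf->].
Qed.

Lemma gen_sum_mul0 x y n : val y \notin lower (val x) n.+1 ->
  gen_sum x n * r y = 0.
Proof.
move=> nyx; rewrite mulr_suml big1 // => z zx; apply: (sp_mul0 rP).
by apply: contra nyx => yz; rewrite -add1n; apply: lower_trans zx yz.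
Qed.

Lemma gen_sum_mul_sum x n : gen_sum x n * gen_sum x n.+1 = 0.
Proof.
rewrite {1}/gen_sum mulr_suml big1 // => z zx; rewrite -[RHS](gen_mul_sum z).
rewrite /gen_sum !mulr_sumr [LHS]big_mkcond [RHS]big_mkcond.
apply: eq_bigr => y _; have [yz|nyz] := boolP (val y \in lower (val z) 1).
  by have := lower_trans zx yz; rewrite add1n => ->.
by rewrite (sp_mul0 rP nyz) if_same.
Qed.

Lemma rann_gen_sum_sub x n (e : R) (c : nonbot G -> R) :
  gen_sum x n * (gen_sum x n.+1 * e +
    \sum_(y : nonbot G | val y \notin lower (val x) n.+1) r y * c y) = 0.
Proof.
rewrite mulrDr mulrA gen_sum_mul_sum mul0r add0r mulr_sumr big1 // => y nyx.
by rewrite mulrA gen_sum_mul0 ?mul0r.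
Qed.

Definition in_combination x m a : Prop :=
  exists (e : R) (c : nonbot G -> R), a = gen_sum x m * e +
    \sum_(y : nonbot G | val y \notin lower (val x) m) r y * c y.

(** Multiplying by r_x(n) and splitting along the r_y R shows that r_y a = 0
    for every y in S_x(n), so the coefficients of a are constant on each S_y(1);
    uniformity extends this to S_x(n+1). *)
Lemma gen_sum_strand (hG : uniform G) x n a :
  (n < lg_rk (val x))%N -> cg_deg 1 a -> gen_sum x n * a = 0 ->
  in_combination x n.+1 a.
Proof.
move=> lt_nx /(sp_degS rP)[c [dc def_a]] xa0.
have /choice[e ce] : forall z, exists e : F, c z = e%:A.
  by move=> z; apply/cg_conn/dc.
have {dc}def_a : a = \sum_z e z *: r z.
  by rewrite def_a; apply: eq_bigr => z _; rewrite ce mulr_algr.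
have ya0 y : val y \in lower (val x) n -> r y * a = 0.
  move=> yx; have := gen_direct rP
    (a := fun z => if val z \in lower (val x) n then a else 0) _ y.
  rewrite yx; apply; rewrite -[RHS]xa0 mulr_suml [RHS]big_mkcond.
  by apply: eq_bigr => z _; case: ifP; rewrite ?mulr0.
(* Uniformity concerns all of Gamma, so e is extended to the bottom; no other
   element has the rank of the bottom, so the value there is harmless. *)
pose eb (z : G) : F := oapp e 0 (insub z).
have eb_const : forall z z' : G, z \in lower (val x) n.+1 ->
    z' \in lower (val x) n.+1 -> eb z = eb z'.
  apply: (uniform_lower_const hG) => y yx z z' zy z'y.
  have y_neq0 : y != lg_bot.
    by rewrite -rank_gt0; move: yx; rewrite inE => /andP[_ /eqP]; lia.
  have rk_z : lg_rk z = lg_rk z'.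
    by move: zy z'y; rewrite !inE => /andP[_ /eqP->] /andP[_ /eqP]; lia.
  have [z0|z_neq0] := eqVneq z lg_bot.
    have /eqP -> : z' == lg_bot by rewrite -[_ == _]negbK -rank_gt0 -rk_z z0 rank_bot.
    by rewrite z0.
  have z'_neq0 : z' != lg_bot by rewrite -rank_gt0 -rk_z rank_gt0.
  rewrite /eb (insubT (fun t => t != lg_bot) z_neq0).
  rewrite (insubT (fun t => t != lg_bot) z'_neq0) /=.
  apply: (@gen_mul_const _ _ _ _ rP (exist _ y y_neq0)) => //.
  by rewrite -def_a; apply: ya0.
have ebE z : eb (val z) = e z by rewrite /eb valK.
pose l : F := if [pick z : nonbot G | val z \in lower (val x) n.+1] is Some z
  then e z else 0.
have lE z : val z \in lower (val x) n.+1 -> e z = l.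
  rewrite /l; case: pickP => [t tx zx|/(_ z)->//].
  by rewrite -!ebE; apply: eb_const.
exists l%:A, (fun y => (e y)%:A); rewrite gen_sum_combination def_a.
apply: eq_bigr => y _; case: ifP => [/lE->|_]; by rewrite mulr_algr.
Qed.

(** The indices of the elements r_x(n) with 0 <= n < rk x; these are exactly
    the nonzero ones. *)
Definition level : finType := {x : nonbot G & 'I_(lg_rk (val x))}.

Implicit Types k : level.

Definition lv_gen k : R := gen_sum (tag k) (tagged k).

(** After r_x(n) come r_x(n+1), if nonzero, and r_y = r_y(0) for y outside
    S_x(n+1); at the beginning come all r_y. *)
Definition lv_step (o : option level) : pred level := fun k =>
  if o is Some j then
    (tag k == tag j) && (tagged k == (tagged j).+1 :> nat) ||
    (val (tag k) \notin lower (val (tag j)) (tagged j).+1) && (tagged k == 0 :> nat)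
  else tagged k == 0 :> nat.

Definition start x : level :=
  Tagged (fun x => 'I_(lg_rk (val x))) (Ordinal (rank_nonbot x)).

Lemma lv_gen_start x : lv_gen (start x) = r x.
Proof. exact: gen_sum0. Qed.

Lemma level_eq k l :
  tag k = tag l -> nat_of_ord (tagged k) = nat_of_ord (tagged l) -> k = l.
Proof.
case: k l => x i [y j] /= exy; move: j; rewrite -exy => j eij.
by congr existT; apply: val_inj.
Qed.

Lemma sum_start (Q : pred (nonbot G)) (g : level -> R) :
  \sum_(k : level | Q (tag k) && (tagged k == 0 :> nat)) g k =
  \sum_(x | Q x) g (start x).
Proof.
rewrite (reindex_onto start (fun k : level => tag k)) => [|k /andP[_ /eqP k0]].
  by apply: eq_bigl => x; rewrite /= !eqxx !andbT.
exact: level_eq.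
Qed.

Definition lv_next (j : level) : option level :=
  omap (fun i => Tagged (fun x => 'I_(lg_rk (val x))) i)
    (insub (tagged j).+1 : option 'I_(lg_rk (val (tag j)))).

Lemma sum_lv_step j (g : level -> R) :
  \sum_(k : level | lv_step (Some j) k) g k = oapp g 0 (lv_next j) +
  \sum_(y : nonbot G | val y \notin lower (val (tag j)) (tagged j).+1) g (start y).
Proof.
rewrite (bigID (fun k => (tag k == tag j) && (tagged k == (tagged j).+1 :> nat))) /=.
congr (_ + _).
  rewrite (eq_bigl (fun k => (tag k == tag j) && (tagged k == (tagged j).+1 :> nat))); last first.
    by move=> k; rewrite andb_orl andbb; case: (_ && _); rewrite ?andbF.
  rewrite /lv_next; case: insubP => [i _ def_i|/negP ninj] /=.
    rewrite (big_pred1 (Tagged (fun x => 'I_(lg_rk (val x))) i)) // => k.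
    apply/andP/eqP=> [[/eqP e1 /eqP e2]|->]; last by rewrite /= def_i !eqxx.
    by apply: level_eq; rewrite /= ?e1 ?e2.
  rewrite big_pred0 // => k; apply/andP=> -[/eqP e1 /eqP e2]; apply: ninj.
  by rewrite -e2 -e1.
rewrite -(sum_start (fun y => val y \notin lower (val (tag j)) (tagged j).+1) g).
apply: eq_bigl => k.
have [/andP[_ /eqP k_m]|_] :=
    boolP ((tag k == tag j) && (nat_of_ord (tagged k) == (tagged j).+1)).
  by rewrite k_m /= andbF.
by rewrite andbT.
Qed.

Lemma spanned_None a : spanned lv_gen lv_step None a <->
  exists c : nonbot G -> R, a = \sum_x r x * c x.
Proof.
split=> -[c ->].
  exists (fun x => c (start x)); rewrite (sum_start predT).
  by apply: eq_bigr => x _; rewrite lv_gen_start.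
exists (fun k => c (tag k)); rewrite (sum_start predT).
by apply: eq_bigr => x _; rewrite lv_gen_start.
Qed.

Lemma spanned_Some j a : spanned lv_gen lv_step (Some j) a <->
  in_combination (tag j) (tagged j).+1 a.
Proof.
split=> [[c ->]|[e [c ->]]].
  exists (oapp c 0 (lv_next j)), (fun y => c (start y)); rewrite sum_lv_step.
  congr (_ + _); last by apply: eq_bigr => y _; rewrite lv_gen_start.
  rewrite /lv_next; case: insubP => [i _ <-|_] //=; by rewrite mulr0.
exists (fun k => if tagged k == 0 :> nat then c (tag k) else e).
rewrite sum_lv_step; congr (_ + _); last first.
  by apply: eq_bigr => y _; rewrite lv_gen_start.
rewrite /lv_next; case: insubP => [i _ def_i|] /=.
  by rewrite def_i /= /lv_gen /= def_i.
rewrite -leqNgt => le; rewrite /gen_sum big_pred0 ?mul0r // => y.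
exact: lower_empty.
Qed.

Lemma lv_direct o (c : level -> R) :
  \sum_(k : level | lv_step o k) lv_gen k * c k = 0 ->
  forall k, lv_step o k -> lv_gen k * c k = 0.
Proof.
case: o => [j|] sum0 k.
  move: sum0; rewrite sum_lv_step.
  pose e := oapp c 0 (lv_next j); pose x := tag j; pose m := (tagged j).+1.
  have -> : oapp (fun k => lv_gen k * c k) 0 (lv_next j) = gen_sum x m * e.
    rewrite /e /lv_next; case: insubP => [i _ def_i|_] /=; last by rewrite mulr0.
    by rewrite /lv_gen /= def_i.
  under eq_bigr do rewrite lv_gen_start.
  rewrite (gen_sum_combination x m e (fun y => c (start y))) => /(gen_direct rP) all0.
  case/orP=> [/andP[/eqP kj /eqP k_m]|/andP[nkx /eqP k0]]; last first.
    rewrite (_ : k = start (tag k)); last exact: level_eq.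
    by rewrite lv_gen_start; have := all0 (tag k); rewrite (negPf nkx).
  rewrite /lv_gen k_m kj -/x -/m {1}/gen_sum mulr_suml big1 // => y yx.
  have := all0 y; rewrite yx /e /lv_next; case: insubP => [i _ def_i|/negP[]] /=.
    rewrite (_ : k = Tagged (fun x => 'I_(lg_rk (val x))) i) //.
    by apply: level_eq; rewrite //= k_m.
  by rewrite -k_m -kj.
move: sum0; rewrite (sum_start predT) => sum0 /eqP k0.
rewrite (_ : k = start (tag k)); last exact: level_eq.
rewrite lv_gen_start; apply: (gen_direct rP (a := fun x => c (start x))).
by rewrite -[RHS]sum0; apply: eq_bigr => x _; rewrite lv_gen_start.
Qed.

Lemma gen_sum_neq0 x n : (n < lg_rk (val x))%N -> gen_sum x n != 0.
Proof.
move=> lt_nx; have [z zx] := lower_neq0 (ltnW lt_nx).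
have z_neq0 : z != lg_bot.
  by rewrite -rank_gt0; move: zx; rewrite inE => /andP[_ /eqP]; lia.
apply/eqP=> x0; have := gen_neq0 rP (exist _ z z_neq0).
rewrite -[r _]mulr1 => /eqP; apply.
have := gen_direct rP (a := fun y => (val y \in lower (val x) n)%:R) _ (exist _ z z_neq0).
rewrite /= zx; apply; rewrite -[RHS]x0 /gen_sum [RHS]big_mkcond.
by apply: eq_bigr => y _; case: ifP; rewrite ?mulr1 ?mulr0.
Qed.

Lemma gen_sum_deg x n : cg_deg 1 (gen_sum x n).
Proof. by apply: (grading_sum (cg_grading R)) => y; apply: sp_deg rP y. Qed.

Lemma lv_complex o a : spanned lv_gen lv_step o a -> ann lv_gen o a.
Proof.
case: o => [j /spanned_Some[e [c ->]]|[c ->]]; first exact: rann_gen_sum_sub.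
rewrite /=; elim/big_ind: _ => [|u v|k _]; first exact: irrelevant0.
  exact: irrelevantD.
exact: irrelevant_mul (irrelevant_hom (gen_sum_deg _ _)) _.
Qed.

Lemma irrelevant_spanned a : a \in @irrelevant F R -> spanned lv_gen lv_step None a.
Proof.
move=> /asboolP[k [f [df ->]]]; elim/big_ind: _ => [|u v|n _].
- exact: spanned0.
- exact: spannedD.
by apply/spanned_None; have [c [_ ->]] := sp_degS rP (df n); exists c.
Qed.

Lemma lv_strand (hG : uniform G) o a :
  cg_deg 1 a -> ann lv_gen o a -> spanned lv_gen lv_step o a.
Proof.
case: o => [j|] da; last exact: irrelevant_spanned.
by move=> ja; apply/spanned_Some/gen_sum_strand.
Qed.

(** Reaching (x, n) through (x, 0), ..., (x, n - 1). *)
Lemma level_path k : exists i (p : paths lv_step i), plast p = Some k.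
Proof.
case: k => x [n lt_nx]; elim: n lt_nx => [|n IH] lt_nx.
  exists 1%N; have [|p _ def_p] := @exists_path_rcons _ lv_step 0 tt (start x).
    by [].
  by exists p; rewrite [LHS](congr1 Some def_p); congr Some; apply: level_eq.
have [i [p last_p]] := IH (ltnW lt_nx); exists i.+1.
have [|p' _ def_p'] := @exists_path_rcons _ lv_step i p (Tagged _ (Ordinal lt_nx)).
  by rewrite last_p /= !eqxx.
by exists p'; rewrite [LHS](congr1 Some def_p').
Qed.

(** Every index ends some path, so exactness of the complex of paths is a
    statement about all the annihilators, together with the equality of R_+ with
    the sum of the r_x R. *)
Lemma koszul_iff_rann (hG : uniform G) : koszul R <->
  forall x n, (n < lg_rk (val x))%N -> forall a, gen_sum x n * a = 0 ->
    in_combination x n.+1 a.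
Proof.
have lv_deg k : cg_deg 1 (lv_gen k) by apply: gen_sum_deg.
have lv_neq0 k : lv_gen k != 0 by apply: gen_sum_neq0; apply: ltn_ord.
split=> [kR x n lt_nx a xa0|ex].
  have [i [p last_p]] := level_path (Tagged (fun x => 'I_(lg_rk (val x))) (Ordinal lt_nx)).
  have := path_exact_of_koszul lv_deg lv_direct lv_neq0 lv_complex (lv_strand hG) kR.
  by move/(_ i p a); rewrite last_p => /(_ xa0)/spanned_Some.
apply: (koszul_of_path_exact lv_deg lv_direct lv_complex) => i p a.
case: (plast p) => [j|]; last exact: irrelevant_spanned.
by move=> ja; apply/spanned_Some/ex.
Qed.

End SplitCriterion.

From mathcomp Require Import classical_sets.

Lemma rgen_sum_gen_sum (F : fieldType) (G : layeredGraph) (x : nonbot G) n :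
  rgen_sum F x n = gen_sum (@rgen F G) x n.
Proof.
rewrite rgen_sumE; case: ltnP => // le_xn.
by rewrite /gen_sum big_pred0 // => y; apply: lower_empty.
Qed.

Theorem theorem3p3 (F : fieldType) (G : layeredGraph) (hG : uniform G) :
  koszul (splitAlg F G) <->
  (forall (x : nonbot G) (n : nat), (n < lg_rk (val x))%N ->
     direct_sum (rann (rgen_sum F x n))
                (rideal (rgen_sum F x n.+1))
                (Hideal F x n.+1)).
Proof.
have rP := splitAlg_presentation F G.
rewrite (koszul_iff_rann rP hG); split=> ex x n lt_nx; last first.
  move=> a xa0; have [eq_rann _] := ex x n lt_nx.
  have : rann (rgen_sum F x n) a by rewrite /rann /= rgen_sum_gen_sum.
  rewrite eq_rann => -[_ [e _ <-]] [_ [c ->] <-].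
  by exists e, c; rewrite rgen_sum_gen_sum.
split; apply/predeqP=> a; split.
- rewrite /rann /= rgen_sum_gen_sum => /(ex x n lt_nx)[e [c ->]].
  exists (rgen_sum F x n.+1 * e); first by exists e.
  by eexists; [exists c; reflexivity|rewrite rgen_sum_gen_sum].
- move=> [_ [e _ <-]] [_ [c ->] <-]; rewrite /rann /= !rgen_sum_gen_sum.
  exact: (rann_gen_sum_sub rP).
- move=> [[e _ <-] [c eq_ec]]; rewrite /=.
  have /(gen_direct rP) all0 : \sum_y rgen F y *
      (if val y \in lower (val x) n.+1 then e else - c y) = 0.
    rewrite -gen_sum_combination -rgen_sum_gen_sum eq_ec -big_split big1 //= => y _.
    by rewrite mulrN subrr.
  rewrite rgen_sum_gen_sum mulr_suml big1 // => y yx.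
  by have := all0 y; rewrite yx.
move=> /= ->; split; first by exists 0; rewrite ?mulr0.
by exists (fun=> 0); rewrite big1 // => y _; rewrite mulr0.
Qed.
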